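(* Assume (C1)–(C4) of the context. Let $u\in C^2_c(E_1)$ and let $$M^{[u]}_t:=u(\mathbf X_t)-u(\mathbf X_0)-\int_0^t\hat Lu(\mathbf X_s)\,ds+\int_0^t\big((A\nabla u,n)\varrho\big)(\mathbf X_s)\,d\ell_s,\quad t\ge0,$$ which is a continuous square-integrable $(\mathcal F^1_t)$-martingale under $\mathbb P_x$ for every $x\in E_1$. Then its quadratic variation process is $\langle M^{[u]}\rangle_t=2\int_0^t(A\nabla u,\nabla u)(\mathbf X_s)\,ds$, i.e. $$\big(M^{[u]}_t\big)^2-2\int_0^t(A\nabla u,\nabla u)(\mathbf X_s)\,ds,\quad t\ge0,$$ is an $(\mathcal F^1_t)$-martingale under $\mathbb P_x$ for every $x\in E_1$.
   Context: Setting. Let $d\ge2$, $\Omega\subset\mathbb R^d$ open, $E:=\overline\Omega$, $A=(a_{ij}):\overline\Omega\to\mathbb R^{d\times d}$ and $\varrho:\overline\Omega\to[0,\infty)$ measurable, $\mu:=\varrho\,dx$. Conditions: (C1) for every $x\in\overline\Omega$, $A(x)$ is symmetric and there is $\gamma(x)>0$ with $\gamma(x)(\xi,\xi)\le(A(x)\xi,\xi)$ for all $\xi\in\mathbb R^d$; (C2) $A$ and $\varrho$ are continuous on $\overline\Omega$ and $\varrho>0$ $dx$-a.e.; (C3) $\sqrt\varrho\in H^{1,2}_{loc}(\overline\Omega)$ and there is $p\ge2$ with $p>d/2$ such that $|\nabla\varrho|/\varrho\in L^p_{loc}(\overline\Omega\cap\{\varrho>0\},\mu)$ (such $p$ is fixed);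 (C4) $\Gamma_2\subset\partial\Omega$ is open in $\partial\Omega$, $\partial\Omega$ is locally $C^2$-smooth at every point of $\Gamma_2$, $\mathrm{cap}_{\mathcal E}(\partial\Omega\setminus\Gamma_2)=0$, and $A\in C^1(\overline\Omega)$. Here $(\mathcal E,D(\mathcal E))$ is the closure in $L^2(\overline\Omega,\mu)$ of $\mathcal E(u,v)=\int_\Omega(A\nabla u,\nabla v)\,d\mu$ on $\mathcal D=\{u\in C_c(\overline\Omega): u\in H^{1,1}_{loc}(\Omega),\ \mathcal E(u,u)<\infty\}$ (known to be closable under (C1),(C2), with closure a strongly local regular Dirichlet form), and $\mathrm{cap}_{\mathcal E}$ is its capacity. Process. Let $E_1:=(\Omega\cup\Gamma_2)\cap\{\varrho>0\}$. It is known that there is a diffusion process $\mathbf M$ (strong Markov, continuous paths on $[0,\infty)$) with state space $\overline\Omega$ and cemetery $\Delta$ (Alexandrov point), whose transition semigroup $(P_t)$ is associated with $(\mathcal E,D(\mathcal E))$ ($P_tf$ is a $\mu$-version of the $L^2$-semigroup of the form applied to $f$ for bounded Borel $f\in\mathcal L^1(\mu)$), for which $E_1$ is invariant (for $x\in E_1$, $\mathbb P_x$-a.s. paths stay in $E_1\cup\{\Delta\}$), and which is $\mathcal L^p$-strong Feller: $P_t\mathcal L^p(\overline\Omega,\mu)\subset C(E_1)$, $t>0$, and likewise for the resolvent kernels $R_\alpha$, $\alpha>0$. $\mathbf M^1=(\mathbf\Omega^1,\mathcal F^1,(\mathcal F^1_t),(\mathbf X_t),(\mathbb P_x)_{x\in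 E_1\cup\{\Delta\}})$ is the restriction of $\mathbf M$ to $E_1$ (restrict to paths staying in $E_1\cup\{\Delta\}$, with the minimum completed admissible filtration); $\mathcal X$ is its lifetime; functions are extended by $0$ to $\Delta$. Functions. $C^2_c(E_1)$: functions that are $C^2$ on $\Omega\cap\{\varrho>0\}$, which together with their derivatives up to order 2 extend continuously to $\Gamma_2\cap\{\varrho>0\}$, with compact support contained in $E_1$. $n$ is the outward unit normal on $\Gamma_2$. For $u\in C_c^2(E_1)$, $$\hat Lu=\sum_{i,j=1}^da_{ij}\partial_i\partial_ju+\sum_{j=1}^d\Big(\sum_{i=1}^d\partial_ia_{ij}+\sum_{i=1}^d\frac1\varrho a_{ji}\partial_i\varrho\Big)\partial_ju .$$ Local time. A strict PCAF on $E_1$ is an $(\mathcal F^1_t)$-adapted $[0,\infty]$-valued process $(A_t)_{t\ge0}$ on $\mathbf\Omega^1$ with $A_0=0$ and a defining set $\Lambda$ ($\mathbb P_x(\Lambda)=1$ for every $x\in E_1$, $\theta_t\Lambda\subset\Lambda$ for the shift $\theta_t$) such that for $\omega\in\Lambda$: $A_t(\omega)<\infty$ for $t<\mathcal X(\omega)$; $t\mapsto A_t(\omega)$ is continuous on $[0,\infty)$; $A_t(\omega)=A_{\mathcal X(\omega)}(\omega)$ for $t\ge\mathcal X(\omega)$; $A_{t+s}(\omega)=A_t(\omega)+A_s(\theta_t\omega)$ for $s,t\ge0$. It is in Revuz correspondence to $\nu$ if $\int_{E_1}h\,U_A^\alpha f\,d\mu=\int_{E_1}(R_\alpha h)f\,d\nu$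 for all Borel $h,f\ge0$ on $E_1$, $\alpha>0$, where $U_A^\alpha f(x)=\mathbb E_x[\int_0^\infty e^{-\alpha s}f(\mathbf X_s)\,dA_s]$. The boundary local time $\ell=(\ell_t)_{t\ge0}$ is the strict PCAF on $E_1$ in Revuz correspondence to $1_{\Gamma_2\cap\{\varrho>0\}}\sigma$, $\sigma$ the surface measure on $\partial\Omega$. The integrals in $M^{[u]}$ converge absolutely on a set of full $\mathbb P_x$-measure for every $x\in E_1$. *)

(* Defs.v *)
From HB Require Import structures.
From mathcomp Require Import all_boot all_order all_algebra.
From mathcomp Require Import all_classical all_reals all_analysis.

Set Implicit Arguments.
Unset Strict Implicit.
Unset Printing Implicit Defensive.
Import Order.TTheory GRing.Theory Num.Theory.
Import numFieldNormedType.Exports.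

Local Open Scope classical_set_scope.
Local Open Scope ring_scope.

Notation borel T := (g_sigma_algebraType (@open T)).

Section Euclidean.
Context {R : realType} {d : nat}.
Local Notation E := 'rV[R]_d.
Implicit Types (U D K B : set E) (f g u v : E -> R) (i j : 'I_d).

Definition dotp (v w : E) : R := \sum_i v 0 i * w 0 i.

(* The library norm on 'rV[R]_d is the maximum norm; it only serves to
   provide the topology. *)
Definition enorm (v : E) : R := Num.sqrt (dotp v v).

(* Vectors are rows, so that A xi is the row xi *m A^T. *)
Definition mxdot (M : 'M[R]_d) (xi eta : E) : R := dotp (xi *m M^T) eta.

Definition partial i f : E -> R := fun x => 'D_(delta_mx 0 i) f x.

(* f is of class C^k on the open set U *)
Fixpoint Ck_on U (k : nat) f : Prop :=
  (forall x, U x -> {for x, continuous f}) /\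
  (if k is k'.+1 then
     forall i, (forall x, U x -> derivable f x (delta_mx 0 i)) /\
               Ck_on U k' (partial i f)
   else True).

Definition extends_continuously U D f : Prop :=
  exists g : E -> R, {within D, continuous g} /\ forall x, U x -> g x = f x.

(* C^1(closure U) *)
Definition C1_closure U f : Prop :=
  [/\ {within closure U, continuous f}, Ck_on U 1 f &
      forall i, extends_continuously U (closure U) (partial i f)].

(* Value at x of the continuous extension of f|_U; this is f x itself when x
   lies in U and f is continuous at x. *)
Definition ext_val U f (x : E) : R := lim (f y @[y --> within U (nbhs x)]).

Definition ext_grad U f (x : E) : E := \row_i ext_val U (partial i f) x.

Definition is_lebesgue (lam : {measure set (borel E) -> \bar R}) : Prop :=
  forall a b : E, (forall i, a 0 i <= b 0 i) ->
    lam [set x | forall i, a 0 i <= x 0 i <= b 0 i] =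
    (\prod_i (b 0 i - a 0 i))%:E.

Definition supported_in D f : Prop :=
  exists K, [/\ compact K, K `<=` D & forall x, ~ K x -> f x = 0].

Definition test_function U f : Prop :=
  (forall k, Ck_on setT k f) /\ supported_in U f.

Section Sobolev.
Variable lam : {measure set (borel E) -> \bar R}.

Definition loc_integrable U f : Prop :=
  forall K, compact K -> K `<=` U -> lam.-integrable K (EFin \o f).

(* u belongs to H^{1,1}_loc(U) and Du is a version of its weak gradient *)
Definition H11_loc U u (Du : E -> E) : Prop :=
  loc_integrable U u /\
  forall i, loc_integrable U (fun x => Du x 0 i) /\
    forall phi, test_function U phi ->
      \int[lam]_(x in U) (u x * partial i phi x) =
      - \int[lam]_(x in U) (Du x 0 i * phi x).

(* u belongs to H^{1,2}_loc(closure U) and Du is a version of its weak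
   gradient *)
Definition H12_loc_closure U u (Du : E -> E) : Prop :=
  H11_loc U u Du /\
  forall K, compact K -> K `<=` closure U ->
    (\int[lam]_(x in K `&` U) (u x ^+ 2)%:E < +oo)%E /\
    (\int[lam]_(x in K `&` U) (dotp (Du x) (Du x))%:E < +oo)%E.

End Sobolev.

Definition bnd U : set E := closure U `\` interior U.

(* Near x, the set U is the sublevel set psi < 0 of a C^2 function whose
   gradient does not vanish. *)
Definition C2_defining U (x : E) (V : set E) (psi : E -> R) : Prop :=
  [/\ open V, V x, Ck_on V 2 psi &
   [/\ forall y, V y -> exists i, partial i psi y != 0,
       U `&` V = [set y | psi y < 0] `&` V &
       bnd U `&` V = [set y | psi y = 0] `&` V]].

Definition C2_smooth_at U (x : E) : Prop :=
  exists V psi, C2_defining U x V psi.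

Definition outward_unit_normal U (x nu : E) : Prop :=
  exists V psi, C2_defining U x V psi /\
    let g : E := \row_i partial i psi x in nu = (enorm g)^-1 *: g.

(* volume of the k-dimensional Euclidean unit ball *)
Fixpoint ball_volume (k : nat) : R :=
  match k with
  | 0 => 1
  | 1 => 2
  | (k'.+1 as k1).+1 => 2 * pi / k1.+1%:R * ball_volume k'
  end.

Definition diam (F : set E) : R :=
  sup [set r | exists x y, [/\ F x, F y & r = enorm (x - y)]].

Definition hausdorff_delta (k : nat) (delta : R) (B : set E) : \bar R :=
  ereal_inf [set s | exists F : nat -> set E,
    [/\ B `<=` \bigcup_n F n,
        forall n x y, F n x -> F n y -> enorm (x - y) <= delta &
        s = (\sum_(0 <= n <oo) (ball_volume k * (diam (F n) / 2) ^+ k)%:E)%E]].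

(* k-dimensional Hausdorff measure, normalised so that it is the surface
   measure on k-dimensional C^1 submanifolds *)
Definition hausdorff (k : nat) (B : set E) : \bar R :=
  ereal_sup [set hausdorff_delta k delta B | delta in [set r | 0 < r]].

End Euclidean.

Section DirichletForm.
Context {R : realType} {d : nat}.
Local Notation E := 'rV[R]_d.
Variables (lam mu : {measure set (borel E) -> \bar R}) (Omega : set E)
          (A : E -> 'M[R]_d).

Definition L2norm (f : E -> R) : \bar R :=
  ('N[mu]_2%:E[EFin \o (f : borel E -> R)])%E.

(* Functions on closure Omega are represented by functions on the whole space;
   mu is concentrated on closure Omega. *)

Definition energy (Du Dv : E -> E) : R :=
  \int[mu]_(x in Omega) mxdot (A x) (Du x) (Dv x).

(* u belongs to the pre-domain of the form, Du is a version of its weak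
   gradient *)
Definition form_core (u : E -> R) (Du : E -> E) : Prop :=
  [/\ {within closure Omega, continuous u}, supported_in (closure Omega) u,
      H11_loc lam Omega u Du &
      (\int[mu]_(x in Omega) (mxdot (A x) (Du x) (Du x))%:E < +oo)%E].

(* u n is an E-Cauchy sequence in the pre-domain converging to f in L^2(mu) *)
Definition form_approx (f : E -> R) (u : nat -> E -> R) (Du : nat -> E -> E)
  : Prop :=
  [/\ forall n, form_core (u n) (Du n),
      forall e : R, 0 < e -> exists N, forall m n, (N <= m)%N -> (N <= n)%N ->
        energy (Du n \- Du m) (Du n \- Du m) < e &
      L2norm (u n \- f) @[n --> \oo] --> 0%E].

Definition form_dom (f : E -> R) : Prop :=
  f \in Lfun mu 2%:E /\ exists u Du, form_approx f u Du.

(* the closure of the form takes the value c at (f, g) *)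
Definition form_val (f g : E -> R) (c : R) : Prop :=
  [/\ form_dom f, form_dom g &
      exists u Du v Dv, [/\ form_approx f u Du, form_approx g v Dv &
        energy (Du n) (Dv n) @[n --> \oo] --> c]].

(* f belongs to the domain of the generator of the form, which maps f to g *)
Definition form_generator (f g : E -> R) : Prop :=
  [/\ form_dom f, g \in Lfun mu 2%:E &
      forall h, form_dom h -> form_val f h (- \int[mu]_x (g x * h x))].

(* Strongly continuous contraction semigroup on L^2(mu), acting on
   representatives *)
Record L2_semigroup (T : R -> (E -> R) -> (E -> R)) : Prop := {
  sg_L2 : forall (t : R) f, 0 <= t -> f \in Lfun mu 2%:E ->
    T t f \in Lfun mu 2%:E;
  sg_linear : forall (t a : R) f g, 0 <= t ->
    f \in Lfun mu 2%:E -> g \in Lfun mu 2%:E ->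
    {ae mu, forall x, T t (fun y => a * f y + g y) x = a * T t f x + T t g x};
  sg_contraction : forall (t : R) f, 0 <= t -> f \in Lfun mu 2%:E ->
    (L2norm (T t f) <= L2norm f)%E;
  sg_id : forall f, f \in Lfun mu 2%:E -> {ae mu, forall x, T 0 f x = f x};
  sg_comp : forall (s t : R) f, 0 <= s -> 0 <= t -> f \in Lfun mu 2%:E ->
    {ae mu, forall x, T (s + t) f x = T s (T t f) x};
  sg_cont : forall f, f \in Lfun mu 2%:E ->
    L2norm (T t f \- f) @[t --> 0^'+] --> 0%E
}.

(* T is the L^2-semigroup of the closure of the form: both have the same
   generator. *)
Definition semigroup_of_form (T : R -> (E -> R) -> (E -> R)) : Prop :=
  L2_semigroup T /\
  forall f g, f \in Lfun mu 2%:E -> g \in Lfun mu 2%:E ->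
    (L2norm (fun x => (T t f x - f x) / t - g x)
       @[t --> 0^'+] --> 0%E
     <-> form_generator f g).

Definition cap_open (U : set E) : \bar R :=
  ereal_inf [set s | exists f c, [/\ form_val f f c,
    {ae mu, forall x, U x -> 1 <= f x} &
    s = (c + \int[mu]_x (f x ^+ 2))%:E]].

Definition cap (B : set E) : \bar R :=
  ereal_inf [set cap_open (V `&` closure Omega) |
             V in [set V : set E | open V /\ B `<=` V]].

End DirichletForm.

Section Conditions.
Context {R : realType} {d : nat}.
Local Notation E := 'rV[R]_d.
Variables (lam mu : {measure set (borel E) -> \bar R}) (Omega : set E)
          (A : E -> 'M[R]_d) (rho : E -> R) (drho : E -> E) (p : R)
          (Gamma2 : set E).

Definition cond1 : Prop :=
  forall x, closure Omega x -> (A x)^T = A x /\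
    exists gamma : R, 0 < gamma /\
      forall xi : E, gamma * dotp xi xi <= mxdot (A x) xi xi.

Definition cond2 : Prop :=
  [/\ forall i j, {within closure Omega, continuous (fun x => A x i j)},
      {within closure Omega, continuous rho} &
      {ae lam, forall x, closure Omega x -> 0 < rho x}].

Definition positive_rho : set E := [set x | 0 < rho x].

(* drho is a version of the weak gradient of rho.  Outside Omega it is an arbitrary
   Borel extension: the process spends Lebesgue-null time in the boundary. *)
Definition cond3 : Prop :=
  [/\ exists G, H12_loc_closure lam Omega (fun x => Num.sqrt (rho x)) G,
      H11_loc lam Omega rho drho,
      forall i, measurable_fun setT (fun x : borel E => drho x 0 i),
      2 <= p /\ d%:R / 2 < p &
      forall K, compact K -> K `<=` closure Omega `&` positive_rho ->
        (\int[mu]_(x in K `&` Omega) ((enorm (drho x) / rho x) `^ p)%:E < +oo)%E].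

Definition cond4 : Prop :=
  [/\ exists V : set E, open V /\ Gamma2 = V `&` bnd Omega,
      forall x, Gamma2 x -> C2_smooth_at Omega x,
      cap lam mu Omega A (bnd Omega `\` Gamma2) = 0%E &
      forall i j, C1_closure Omega (fun x => A x i j)].

Definition E1 : set E := (Omega `|` Gamma2) `&` positive_rho.

(* elements of C^2_c(E_1), extended by 0 to the whole space *)
Definition C2c (u : E -> R) : Prop :=
  let U := Omega `&` positive_rho in
  [/\ Ck_on U 2 u, {within E1, continuous u},
      forall i, extends_continuously U E1 (partial i u),
      forall i j, extends_continuously U E1 (partial i (partial j u)) &
      supported_in E1 u].

Definition Lhat (u : E -> R) (x : E) : R :=
  \sum_i \sum_j A x i j * ext_val Omega (partial i (partial j u)) x +
  \sum_j (\sum_i ext_val Omega (partial i (fun y => A y i j)) x +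
          \sum_i (rho x)^-1 * A x j i * drho x 0 i) *
         ext_val Omega (partial j u) x.

(* (A grad u, n) rho on Gamma2, extended by 0 *)
Definition flux (n : E -> E) (u : E -> R) (x : E) : R :=
  \1_Gamma2 x * (mxdot (A x) (ext_grad Omega u x) (n x) * rho x).

End Conditions.

Section Process.
Context {R : realType} {d : nat}.
Local Notation E := 'rV[R]_d.
(* The cemetery is None.  If F is closed in R^d, the Alexandrov
   compactification of F is the subspace of S formed by F and None, also when F
   is compact (None is then isolated in it). *)
Local Notation S := (one_point_compactification E).
Local Notation R' := (measurableTypeR R).
Context {dW : measure_display} {W : measurableType dW}.
Variables (X : R -> W -> S) (theta : R -> W -> W)
          (P : R.-pker (borel S) ~> W).

Definition ext0 (f : E -> R) (s : S) : R := if s is Some x then f x else 0.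

Definition with_cemetery (F : set E) : set S :=
  [set s | if s is Some x then F x else True].

(* sigma(X_s, s <= t) *)
Definition raw_filtration (t : R) : set (set W) :=
  <<s [set B | exists (s : R) (C : set (borel S)),
         [/\ 0 <= s <= t, measurable C & B = X s @^-1` C]] >>.

(* Completion of the trace on W0 of the sigma-algebra G with respect to the
   laws P_nu = \int P_x nu(dx), for all initial laws nu on S0. *)
Definition completed (G : set (set W)) (S0 : set S) (W0 : set W)
  : set (set W) :=
  [set B | B `<=` W0 /\ forall nu : probability (borel S) R,
     nu S0 = 1%E -> exists C N, [/\ G C, measurable N,
       (\int[nu]_x P x N = 0)%E &
       (B `\` (C `&` W0)) `|` ((C `&` W0) `\` B) `<=` N]].

(* Integrals of functions that are measurable only for the completion of P_x
   are those of the completed measure: the library integral of a nonnegative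
   function is the supremum over simple measurable functions below it. *)

(* Strong Markov property with respect to the right-continuous filtration
   F_{t+}: tau is a stopping time of (F_{t+}) and B belongs to F_{tau+}. *)
Definition strong_markov (S0 : set S) : Prop :=
  let F t := completed (raw_filtration t) S0 setT in
  forall (tau : W -> \bar R) (B : set W),
    (forall w, 0 <= tau w)%E ->
    (forall t : R, 0 < t -> F t [set w | (tau w < t%:E)%E]) ->
    completed measurable S0 setT B ->
    (forall t : R, 0 < t -> F t (B `&` [set w | (tau w < t%:E)%E])) ->
  forall (s : R) (C : set (borel S)) (x : S), 0 <= s -> measurable C -> S0 x ->
    let B' := B `&` [set w | (tau w < +oo)%E] in
    (\int[P x]_(w in B') (\1_C (X (fine (tau w) + s) w))%:E =
     \int[P x]_(w in B') P (X (fine (tau w)) w) [set w' | C (X s w')])%E.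

(* diffusion with state space F and cemetery None *)
Record diffusion (F : set E) : Prop := {
  diff_sigma : forall B : set W, measurable B <->
    <<s [set B | exists (s : R) (C : set (borel S)),
           [/\ 0 <= s, measurable C & B = X s @^-1` C]] >> B;
  diff_state : forall (t : R) w, 0 <= t -> with_cemetery F (X t w);
  diff_shift : forall (s t : R) w, 0 <= s -> 0 <= t ->
    X s (theta t w) = X (s + t) w;
  diff_cont : forall w, {within `[0, +oo[, continuous (fun t : R => X t w)};
  diff_dead : forall (s t : R) w, 0 <= s <= t -> X s w = None -> X t w = None;
  diff_normal : forall x, with_cemetery F x -> P x [set w | X 0 w = x] = 1%E;
  diff_markov : strong_markov (with_cemetery F)
}.

Definition halfline : set R := `[0, +oo[%classic.

Definition transition (t : R) (f : E -> R) (x : E) : R :=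
  \int[P (Some x)]_w ext0 f (X t w).

(* resolvent kernel R_alpha f for f >= 0 *)
Definition resolvent_nneg (alpha : R) (f : E -> R) (x : E) : \bar R :=
  (\int[@lebesgue_measure R]_(t in halfline)
     ((expR (- alpha * t))%:E * \int[P (Some x)]_w (ext0 f (X t w))%:E))%E.

Definition resolvent (alpha : R) (f : E -> R) (x : E) : R :=
  \int[@lebesgue_measure R]_(t in halfline)
     (expR (- alpha * t) * transition t f x).

Definition associated_with_form (lam mu : {measure set (borel E) -> \bar R})
    (Omega : set E) (A : E -> 'M[R]_d) : Prop :=
  exists T, semigroup_of_form lam mu Omega A T /\
    forall (t : R) f, 0 < t -> f \in Lfun mu 1%:E ->
      (exists M, forall x, `|f x| <= M) ->
      {ae mu, forall x, transition t f x = T t f x}.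

(* Functions in calL^p(mu) are not identified when they agree a.e. *)
Definition Lp_strong_feller (mu : {measure set (borel E) -> \bar R}) (p : R)
    (F : set E) : Prop :=
  forall f, f \in Lfun mu p%:E ->
    (forall t : R, 0 < t ->
       (forall x, F x -> (P (Some x)).-integrable setT
                           (fun w => (ext0 f (X t w))%:E)) /\
       {within F, continuous (transition t f)}) /\
    (forall alpha : R, 0 < alpha ->
       (forall x, F x ->
          (resolvent_nneg alpha (fun y => `|f y|%R) x < +oo)%E) /\
       {within F, continuous (resolvent alpha f)}).

(* paths of the restriction of the process to F *)
Definition restricted_paths (F : set E) : set W :=
  [set w | forall t : R, 0 <= t -> with_cemetery F (X t w)].

Definition invariant_set (F : set E) : Prop :=
  forall x, F x -> {ae P (Some x), forall w, restricted_paths F w}.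

(* minimum completed admissible filtration of the restriction to F *)
Definition restricted_filtration (F : set E) (t : R) : set (set W) :=
  completed (raw_filtration t) (with_cemetery F) (restricted_paths F).

Definition lifetime (w : W) : \bar R :=
  ereal_inf [set t%:E | t in [set t : R | 0 <= t /\ X t w = None]].

(* Lebesgue-Stieltjes measure dF on (0, oo) cap {F < oo}, for F continuous and
   nondecreasing with values in [0, oo] and F 0 = 0.  For an additive functional,
   F is constant after the lifetime, and so no mass is lost before it. *)
Definition is_stieltjes (F : R -> \bar R)
    (m : {measure set R' -> \bar R}) : Prop :=
  (forall a b : R, 0 <= a <= b -> (F b < +oo)%E ->
     m `]a, b]%classic = (F b - F a)%E) /\
  m [set s | s <= 0 \/ F s = +oo%E] = 0%E.

Definition stieltjes (F : R -> \bar R) : {measure set R' -> \bar R} :=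
  if pselect (exists m, is_stieltjes F m) is left h then projT1 (cid h)
  else mzero.

Record strict_PCAF (F : set E) (L : R -> W -> \bar R) : Prop := {
  pcaf_ge0 : forall (t : R) w, 0 <= t -> restricted_paths F w -> (0 <= L t w)%E;
  pcaf_adapted : forall (t : R) (C : set (borel (\bar R))), 0 <= t -> measurable C ->
    restricted_filtration F t (restricted_paths F `&` L t @^-1` C);
  pcaf_0 : forall w, restricted_paths F w -> L 0 w = 0%E;
  pcaf_defining : exists Lambda : set W,
    [/\ completed measurable (with_cemetery F) (restricted_paths F) Lambda,
        forall x, F x -> {ae P (Some x), forall w, Lambda w},
        forall (t : R) w, 0 <= t -> Lambda w -> Lambda (theta t w) &
        forall w, Lambda w ->
        [/\ forall t : R, 0 <= t -> (t%:E < lifetime w)%E -> (L t w < +oo)%E,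
            {within `[0, +oo[, continuous (fun t => L t w)},
            forall t : R, 0 <= t -> (lifetime w <= t%:E)%E ->
              L t w = L (fine (lifetime w)) w &
            forall s t : R, 0 <= s -> 0 <= t ->
              L (t + s) w = (L t w + L s (theta t w))%E]]
}.

Definition PCAF_potential (F : set E) (L : R -> W -> \bar R) (alpha : R)
    (f : E -> R) (x : E) : \bar R :=
  (\int[P (Some x)]_(w in restricted_paths F)
     \int[stieltjes (L^~ w)]_(s in halfline)
        (expR (- alpha * s) * ext0 f (X s w))%:E)%E.

Definition revuz (mu nu : {measure set (borel E) -> \bar R}) (F : set E)
    (L : R -> W -> \bar R) : Prop :=
  forall (h f : borel E -> R) (alpha : R),
    measurable_fun setT h -> measurable_fun setT f ->
    (forall x, 0 <= h x) -> (forall x, 0 <= f x) -> 0 < alpha ->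
    (\int[mu]_(x in F) ((h x)%:E * PCAF_potential F L alpha f x) =
     \int[nu]_(x in F) (resolvent_nneg alpha h x * (f x)%:E))%E.

End Process.

Section Martingales.
Context {R : realType} {dW : measure_display} {W : measurableType dW}.
(* F is a filtration on the subset W0 of W, and Pr a law carried by W0. *)
Variables (F : R -> set (set W)) (W0 : set W)
          (Pr : {measure set W -> \bar R}).
Implicit Types M Q : R -> W -> R.

Definition adapted M : Prop :=
  forall (t : R) (C : set (measurableTypeR R)), 0 <= t -> measurable C ->
    F t (W0 `&` M t @^-1` C).

Record martingale M : Prop := {
  mart_adapted : adapted M;
  mart_integrable : forall t : R, 0 <= t ->
    (\int[Pr]_(w in W0) `|M t w|%:E < +oo)%E;
  mart_cond : forall (s t : R) B, 0 <= s <= t -> F s B ->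
    (\int[Pr]_(w in B) (M t w)%:E = \int[Pr]_(w in B) (M s w)%:E)%E
}.

Record continuous_L2_martingale M : Prop := {
  cmart_mart : martingale M;
  cmart_cont : {ae Pr, forall w, W0 w ->
    {within `[0, +oo[, continuous (fun t => M t w)}};
  cmart_L2 : forall t : R, 0 <= t -> (\int[Pr]_(w in W0) (M t w ^+ 2)%:E < +oo)%E
}.

(* Q is the quadratic variation process <M> of M. *)
Record quadratic_variation M Q : Prop := {
  qv_adapted : adapted Q;
  qv_increasing : {ae Pr, forall w, W0 w ->
    [/\ Q 0 w = 0, {within `[0, +oo[, continuous (fun t => Q t w)} &
        forall s t : R, 0 <= s <= t -> Q s w <= Q t w]};
  qv_martingale : martingale (fun t w => M t w ^+ 2 - Q t w)
}.

End Martingales.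

Section Functionals.
Context {R : realType} {d : nat}.
Local Notation E := 'rV[R]_d.
Local Notation S := (one_point_compactification E).
Context {dW : measure_display} {W : measurableType dW}.
Variables (X : R -> W -> S) (Omega : set E) (A : E -> 'M[R]_d) (rho : E -> R)
          (drho : E -> E) (Gamma2 : set E) (n : E -> E)
          (ell : R -> W -> \bar R).

Definition Mproc (u : E -> R) (t : R) (w : W) : R :=
  ext0 u (X t w) - ext0 u (X 0 w)
  - \int[@lebesgue_measure R]_(s in `[0, t]%classic)
      ext0 (Lhat Omega A rho drho u) (X s w)
  + \int[stieltjes (ell^~ w)]_(s in `[0, t]%classic)
      ext0 (flux Omega A rho Gamma2 n u) (X s w).

(* the two integrals above converge absolutely for every t *)
Definition Mproc_defined (u : E -> R) (w : W) : Prop :=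
  forall t : R, 0 <= t ->
  (@lebesgue_measure R).-integrable `[0, t]%classic
    (fun s => (ext0 (Lhat Omega A rho drho u) (X s w))%:E) /\
  (stieltjes (ell^~ w)).-integrable `[0, t]%classic
    (fun s => (ext0 (flux Omega A rho Gamma2 n u) (X s w))%:E).

(* 2 \int_0^t (A grad u, grad u)(X_s) ds *)
Definition Mbracket (u : E -> R) (t : R) (w : W) : R :=
  2 * \int[@lebesgue_measure R]_(s in `[0, t]%classic)
        ext0 (fun x => mxdot (A x) (ext_grad Omega u x) (ext_grad Omega u x)) (X s w).

End Functionals.

(* Main.v *)
(* Write U = u(X) = U_0 + M + V with M = M^[u], so that V is continuous of finite
   variation.  Since u^2 is again in C^2_c(E_1), with
   Lhat (u^2) = 2 u Lhat u + 2 (A grad u, grad u) and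
   (A grad (u^2), n) = 2 u (A grad u, n), the process
     N = M^[u^2] = U^2 - U_0^2 - 2 int U dV - Q,   Q = 2 int (A grad u, grad u)(X_s) ds,
   is a martingale too.  Along a partition,
     d(M^2 - Q) = dN + 2 (M_k - U_k) dM + r_k,
     r_k = - dV (dM + dU) + 2 int (U - U_k) dV,
   and sum |r_k| -> 0 along refining partitions, path by path.  Only absolute
   convergence of the integrals in V is used, so V need not have integrable
   variation; instead the sums are stopped when |M| exceeds c.  The stopped
   transforms are bounded in L^2, M^2 is dominated by Doob's inequality, hence
   the stopped remainders converge to 0 in mean; finally c -> oo. *)
From HB Require Import structures.
Require Import Defs.
From mathcomp Require Import all_boot all_order all_algebra.
From mathcomp Require Import all_classical all_reals all_analysis.
From mathcomp Require Import measurable_realfun ring lra.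

Set Implicit Arguments.
Unset Strict Implicit.
Unset Printing Implicit Defensive.
Import Order.TTheory GRing.Theory Num.Theory.
Import numFieldNormedType.Exports.
Import HBNNSimple.

Local Open Scope classical_set_scope.
Local Open Scope ring_scope.

(** * Square-integrable functions *)

(** No limit of the sums of (dM)^2 is ever computed. The increments of M^2 and of N bring (dM)^2 and
    (dU)^2 with opposite signs, and (dM)^2 - (dU)^2 = - dV (dM + dU): what is left is either a
    martingale transform or carries a factor dV. This is how M^[u^2] takes the place of Ito's
    formula, and why dM has the coefficient M_k - U_k. Two obstacles shape the rest. The filtration
    is completed over all initial laws and the path space W0 need not be measurable, so M_t agrees
    with a function measurable for the raw past only off a null set depending on t. The
    probabilistic argument therefore runs on raw versions, which inherit no path regularity, and
    inspects them at dyadic times only; the path-by-path estimate is made for M itself, and the two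
    meet at these countably many times. Moreover, stopping takes place on the grid, through the
    running maximum, so M may overshoot c at the stopping index; its value there is controlled by
    the Doob majorant and not by c. *)

Section square_integrable.
Context d (T : measurableType d) (R : realType) (P : probability T R).
Implicit Types f g h : T -> R.

Definition sq_integrable f :=
  measurable_fun setT f /\ P.-integrable setT (EFin \o (fun x => f x ^+ 2)).

Lemma dom_integrable f g : measurable_fun setT f ->
  P.-integrable setT (EFin \o g) -> (forall x, `|f x| <= g x) ->
  P.-integrable setT (EFin \o f).
Proof.
move=> mf ig fg; apply: le_integrable ig => //; first exact/measurable_EFinP.
by move=> x _ /=; rewrite lee_fin (le_trans (fg x))// ler_norm.
Qed.

Lemma integrable_addr f g : P.-integrable setT (EFin \o f) ->
  P.-integrable setT (EFin \o g) ->
  P.-integrable setT (EFin \o (fun x => f x + g x)).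
Proof. by move=> fi gi; exact: (integrableD measurableT fi gi). Qed.

Lemma integrable_scaler c f : P.-integrable setT (EFin \o f) ->
  P.-integrable setT (EFin \o (fun x => c * f x)).
Proof. by move=> fi; exact: (integrableZl measurableT c fi). Qed.

Lemma integrable_cstr (c : R) : P.-integrable setT (EFin \o cst c).
Proof. exact: finite_measure_integrable_cst. Qed.

Lemma sq_integrable_mul f g : sq_integrable f -> sq_integrable g ->
  P.-integrable setT (EFin \o (fun x => f x * g x)).
Proof.
move=> [mf fi] [mg gi].
apply: (dom_integrable _ (integrable_addr fi gi)); first exact: measurable_funM.
by move=> x; rewrite ler_norml; apply/andP; split; nra.
Qed.

Lemma sq_integrable_int f : sq_integrable f -> P.-integrable setT (EFin \o f).
Proof.
move=> [mf fi].
apply: (dom_integrable mf (integrable_addr fi (integrable_cstr 1))) => x /=.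
by rewrite ler_norml; apply/andP; split; nra.
Qed.

Lemma sq_integrable_bounded_mul c f g : sq_integrable g ->
  measurable_fun setT f -> (forall x, `|f x| <= c) ->
  sq_integrable (fun x => f x * g x).
Proof.
move=> [mg gi] mf fc; split; first exact: measurable_funM.
apply: (dom_integrable _ (integrable_scaler (c ^+ 2) gi)).
  by apply: measurable_funX; exact: measurable_funM.
move=> x; rewrite exprMn (ger0_norm (mulr_ge0 (sqr_ge0 _) (sqr_ge0 _))).
rewrite ler_wpM2r ?sqr_ge0// -(real_normK (num_real (f x))).
have c0 := le_trans (normr_ge0 _) (fc x).
by rewrite lerXn2r ?nnegrE.
Qed.

Lemma sq_integrableD f g : sq_integrable f -> sq_integrable g ->
  sq_integrable (fun x => f x + g x).
Proof.
move=> [mf fi] [mg gi]; split; first exact: measurable_funD.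
apply: (dom_integrable _ (integrable_scaler 2 (integrable_addr fi gi))).
  by apply: measurable_funX; exact: measurable_funD.
by move=> x; rewrite ger0_norm ?sqr_ge0//; have := sqr_ge0 (f x - g x); nra.
Qed.

Lemma sq_integrable_bounded c f : measurable_fun setT f ->
  (forall x, `|f x| <= c) -> sq_integrable f.
Proof.
move=> mf fc; split=> //.
apply: (dom_integrable _ (integrable_cstr (c ^+ 2))).
  exact: measurable_funX.
move=> x /=; rewrite normrX lerXn2r ?nnegrE// ?(le_trans _ (fc x))//.
Qed.

Lemma sq_integrableN f : sq_integrable f -> sq_integrable (fun x => - f x).
Proof.
move=> fi; under eq_fun do rewrite -mulN1r.
by apply: (@sq_integrable_bounded_mul 1) => // x; rewrite normrN1.
Qed.

Lemma sq_integrableB f g : sq_integrable f -> sq_integrable g ->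
  sq_integrable (fun x => f x - g x).
Proof. by move=> fi /sq_integrableN; exact: sq_integrableD. Qed.

Lemma sq_integrable_le f g : measurable_fun setT f -> sq_integrable g ->
  (forall x, `|f x| <= `|g x|) -> sq_integrable f.
Proof.
move=> mf [mg gi] fg; split=> //.
apply: (dom_integrable (measurable_funX 2 mf) gi) => x.
by rewrite normrX -[leRHS]real_normK ?num_real// lerXn2r ?nnegrE.
Qed.

Lemma Rintegral_sum n (F : 'I_n -> T -> R) :
  (forall i, P.-integrable setT (EFin \o F i)) ->
  \int[P]_x (\sum_(i < n) F i x) = \sum_(i < n) \int[P]_x F i x.
Proof.
move=> Fi; rewrite /Rintegral.
under eq_integral do rewrite -sumEFin.
rewrite integral_sum//= -sum_fine// => i _.
by apply: integrable_fin_num => //; exact: Fi.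
Qed.

Lemma Rdominated_cvg (f_ : (T -> R)^nat) f g :
  (forall n, measurable_fun setT (f_ n)) -> measurable_fun setT f ->
  {ae P, forall x, f_ n x @[n --> \oo] --> f x} ->
  P.-integrable setT (EFin \o g) ->
  (forall x n, `|f_ n x| <= g x) ->
  (\int[P]_x f_ n x)%R @[n --> \oo] --> (\int[P]_x f x)%R.
Proof.
move=> mf_ mf cf ig dg.
have fi : P.-integrable setT (EFin \o f) /\
    (\int[P]_x (f_ n x)%:E)%E @[n --> \oo] --> (\int[P]_x (f x)%:E)%E.
  have [] := @dominated_convergence _ _ _ P setT measurableT
    (fun n => EFin \o f_ n) (EFin \o f) (EFin \o g).
  - by move=> n; exact/measurable_EFinP.
  - exact/measurable_EFinP.
  - apply: filterS cf => x h _.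
    by apply: cvg_comp h _; exact: cvg_id.
  - exact: ig.
  - by apply: aeW => x n _ /=; rewrite lee_fin.
  by move=> ? _ ?; split.
apply: fine_cvg; rewrite fineK; first by have [] := fi.
by apply: integrable_fin_num => //; case: fi.
Qed.

Lemma sub_sigma_measurable_fun (G : set (set T)) h :
  <<s G >> `<=` measurable ->
  measurable_fun setT (h : g_sigma_algebraType G -> R) -> measurable_fun setT h.
Proof. by move=> sG mh _ C mC; apply: sG; exact: mh. Qed.

(** This stands in for conditional expectation. Each of the positive and negative parts k of h is an
    increasing limit of simple functions measurable for [<<s G >>], for which the claim is a finite
    combination of instances of the hypothesis; |k f| is integrable and dominates the passage to the
    limit. *)
Lemma orthogonal_sub_sigma (G : set (set T)) h f :
  <<s G >> `<=` measurable ->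
  measurable_fun setT (h : g_sigma_algebraType G -> R) ->
  sq_integrable h -> sq_integrable f ->
  (forall B, <<s G >> B -> \int[P]_x (\1_B x * f x) = 0) ->
  \int[P]_x (h x * f x) = 0.
Proof.
move=> sG + + fi f0.
have pos k : measurable_fun setT (k : g_sigma_algebraType G -> R) ->
    sq_integrable k -> (forall x, 0 <= k x) -> \int[P]_x (k x * f x) = 0.
  move=> mk ki k0.
  have mEk : measurable_fun setT
      (EFin \o k : g_sigma_algebraType G -> \bar R) by exact/measurable_EFinP.
  pose a0 n := nnsfun_approx measurableT mEk n.
  pose a n (x : g_sigma_algebraType G) : R := a0 n x.
  have ak n x : 0 <= a n x <= k x.
    apply/andP; split; first by rewrite /a; apply: fun_ge0.
    rewrite -lee_fin /a /a0 nnsfun_approxE.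
    by apply: (@le_approx _ _ _ setT (EFin \o k)) => // y _; rewrite lee_fin.
  have ma n : measurable_fun setT (a n : T -> R).
    apply: (@sub_sigma_measurable_fun G) => //.
  have mf := fi.1.
  have aE0 n : \int[P]_x (a n x * f x) = 0.
    have iE (B : set T) : <<s G >> B ->
        P.-integrable setT (EFin \o (fun x => \1_B x * f x)).
      move=> GB; apply: sq_integrable_mul => //.
      apply: (@sq_integrable_bounded 1) => [|x].
        by apply: measurable_indic; exact: sG.
      by rewrite indicE; case: (_ \in _); rewrite ?normr1 ?normr0.
    have mB (y : R) : <<s G >> (a n @^-1` [set y]).
      by have := @measurable_funPTI _ _ _ _ (a0 n) [set y] (measurable_set1 y).
    under eq_Rintegral.
      move=> x _; rewrite /a fimfunEord mulr_suml.
      under eq_bigr do rewrite -mulrA.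
      over.
    rewrite Rintegral_sum => [|i]; last by apply/integrable_scaler/iE; exact: mB.
    rewrite big1// => i _.
    by rewrite RintegralZl ?f0 ?mulr0//; apply: iE; exact: mB.
  suff : (\int[P]_x (a n x * f x))%R @[n --> \oo] --> (\int[P]_x (k x * f x))%R.
    under eq_cvg do rewrite aE0.
    move=> /cvg_lim <-//; exact: lim_cst.
  apply: (@Rdominated_cvg _ _ (fun x => `|k x * f x|)).
  - by move=> n; exact: measurable_funM.
  - by apply: measurable_funM => //; exact: ki.1.
  - apply: aeW => x; apply: cvgMl.
    have k0' y : [set: g_sigma_algebraType G] y -> (0 <= (EFin \o k) y)%E.
      by rewrite lee_fin.
    have := @cvg_nnsfun_approx _ _ _ _ measurableT _ mEk k0' x I.
    by move=> /fine_cvgP[].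
  - exact/integrable_norm/sq_integrable_mul.
  - move=> x n; rewrite !normrM ler_wpM2r// !ger0_norm//; by case/andP: (ak n x).
move=> mh hi.
have mhn : measurable_fun setT (h^\- : g_sigma_algebraType G -> R).
  exact: measurable_funrneg.
have mhp : measurable_fun setT (h^\+ : g_sigma_algebraType G -> R).
  exact: measurable_funrpos.
have hle x : (`|h^\+ x| <= `|h x|) /\ (`|h^\- x| <= `|h x|).
  have hE : h^\+ x + h^\- x = `|h x| := congr1 (@^~ x) (funrposDneg h).
  by rewrite -hE !ger0_norm ?funrpos_ge0 ?funrneg_ge0// lerDl lerDr.
have ip : sq_integrable h^\+.
  apply: (sq_integrable_le _ hi) => [|x]; first exact: sub_sigma_measurable_fun mhp.
  by have [] := hle x.
have im : sq_integrable h^\-.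
  apply: (sq_integrable_le _ hi) => [|x]; first exact: sub_sigma_measurable_fun mhn.
  by have [] := hle x.
have -> : \int[P]_x (h x * f x) =
    \int[P]_x (h^\+ x * f x - h^\- x * f x).
  apply: eq_Rintegral => x _; rewrite -mulrBl; congr (_ * _).
  exact/esym/(congr1 (@^~ x) (funrposBneg h)).
rewrite RintegralB//; [|exact: sq_integrable_mul..].
by rewrite !pos ?subrr// => x; rewrite ?funrpos_ge0 ?funrneg_ge0.
Qed.

End square_integrable.

(** * Discrete martingales *)

Section running_maximum.
Context (R : realType).
Implicit Type x : nat -> R.

Fixpoint run_max x m : R :=
  if m is m'.+1 then Num.max (run_max x m') `|x m| else `|x 0|.

Lemma run_max_ge0 x m : 0 <= run_max x m.
Proof. by elim: m => [|m ih] //=; rewrite le_max ih. Qed.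

Lemma norm_le_run_max x m : `|x m| <= run_max x m.
Proof. by case: m => [|m] //=; rewrite le_max lexx orbT. Qed.

Lemma run_max_le x m b : (run_max x m <= b) <-> (forall k, (k <= m)%N -> `|x k| <= b).
Proof.
elim: m => [|m ih] /=.
  by split=> [h k|]; [rewrite leqn0 => /eqP->|exact].
rewrite ge_max; split=> [/andP[/ih h1 h2] k|h].
  by rewrite leq_eqVlt => /predU1P[->//|]; rewrite ltnS; exact: h1.
by apply/andP; split; [apply/ih => k km; apply: h; exact: leqW|exact: h].
Qed.

(** The value at 0 is 1, so that |sgn a| = 1 throughout; [sgn a] is a subgradient of the absolute
    value at a. *)
Definition sgn (a : R) : R := if a < 0 then -1 else 1.

(* Trajectorial form of Doob's L^2 inequality: the sum is the value at m of a
   martingale transform. *)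
Lemma trajectorial_doob x m :
  run_max x m ^+ 2 <= 4 * x m ^+ 2 -
    4 * \sum_(k < m) run_max x k * sgn (x k) * (x k.+1 - x k).
Proof.
have sgnE a : sgn a * a = `|a|.
  by rewrite /sgn; case: ltrP => ha; rewrite ?(ltr0_norm ha) ?mulN1r ?mul1r ?ger0_norm.
have sgn_le a b : sgn a * (b - a) <= `|b| - `|a|.
  rewrite mulrBr sgnE lerD2r /sgn; case: ifP => _; rewrite ?mulN1r ?mul1r ?ler_norm//.
  by rewrite -normrN ler_norm.
(* With r the running maximum and a = |x m|, the bound r^2 / 2 + S <= r a gives 4 a^2 - 4 S >= (r -
   2 a)^2 + r^2. In the induction only a new maximum y needs an argument, and there the slack is (y
   - r)^2 / 2. *)
suff h : run_max x m ^+ 2 / 2 +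
    \sum_(k < m) run_max x k * sgn (x k) * (x k.+1 - x k) <= run_max x m * `|x m|.
  have h1 : `|x m| ^+ 2 = x m ^+ 2 by rewrite real_normK ?num_real.
  have := sqr_ge0 (run_max x m - 2 * `|x m|).
  by rewrite -h1; nra.
elim: m => [|m ih]; first by rewrite big_ord0 addr0 /=; have := sqr_ge0 `|x 0|; nra.
rewrite big_ord_recr /=.
have b0 := run_max_ge0 x m; have hx := norm_le_run_max x m.
have := ler_wpM2l b0 (sgn_le (x m) (x m.+1)); rewrite mulrA => h1.
set S := \sum_(_ < _) _ in ih *.
have [h2|h2] := leP `|x m.+1| (run_max x m); first by nra.
have := sqr_ge0 (`|x m.+1| - run_max x m); nra.
Qed.

(** Once [I] fails it fails for ever, so the weights cut the telescoping sum at the first index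
    where [I] fails, or at m if there is none: j is the stopping index. *)
Lemma stopped_telescope x (I : nat -> bool) m :
  (forall k, I k.+1 -> I k) ->
  exists2 j, (j <= m)%N &
    ((forall k, (k < m)%N -> I k) -> j = m) /\
    forall a : nat -> R, \sum_(k < m) (if I k then 1 else 0) * (a k.+1 - a k) = a j - a 0.
Proof.
move=> Idec; elim: m => [|m [j jm [jI jE]]].
  by exists 0 => //; split=> // a; rewrite big_ord0 subrr.
have Iall k i : I k -> (i <= k)%N -> I i.
  elim: k => [|k ih]; first by rewrite leqn0 => ? /eqP->.
  move=> Ik; rewrite leq_eqVlt => /predU1P[->//|].
  by apply: ih; exact: Idec.
case Im : (I m).
  have jm' : j = m by apply: jI => k km; apply: (Iall m) => //; exact: ltnW.
  exists m.+1 => //; split=> // a; rewrite big_ord_recr/= jE jm' Im mul1r.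
  by rewrite addrC subrKA.
exists j; first exact: leqW.
split=> [h|a]; first by have := h m (ltnSn _); rewrite Im.
by rewrite big_ord_recr/= jE Im mul0r addr0.
Qed.

End running_maximum.

Section discrete_martingale.
Context d (T : measurableType d) (R : realType) (P : probability T R).
Variable G : nat -> set (set T).
Hypothesis subG : forall k, <<s G k >> `<=` measurable.
Hypothesis incG : forall k, <<s G k >> `<=` <<s G k.+1 >>.
Implicit Types H M : nat -> T -> R.

Definition adapted_seq H :=
  forall k, measurable_fun setT (H k : g_sigma_algebraType (G k) -> R).

(** The martingale property is orthogonality of increments to indicators of past events;
    [orthogonal_increment] extends it to square-integrable past functions. The family [G k] may be
    mere generators, measurability being stated through [g_sigma_algebraType (G k)]. *)
Record L2_martingale M : Prop := {
  L2m_adapted : adapted_seq M;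
  L2m_sq : forall k, sq_integrable P (M k);
  L2m_incr : forall k B, <<s G k >> B ->
    \int[P]_x (\1_B x * (M k.+1 x - M k x)) = 0 }.

Definition transform H M m (x : T) : R :=
  \sum_(k < m) H k x * (M k.+1 x - M k x).

Lemma adaptedS k (h : T -> R) :
  measurable_fun setT (h : g_sigma_algebraType (G k) -> R) ->
  measurable_fun setT (h : g_sigma_algebraType (G k.+1) -> R).
Proof. by move=> mh mT C mC; apply: incG; exact: mh. Qed.

Lemma adapted_measurable k (h : T -> R) :
  measurable_fun setT (h : g_sigma_algebraType (G k) -> R) -> measurable_fun setT h.
Proof. exact: sub_sigma_measurable_fun. Qed.

Lemma orthogonal_increment k (h : T -> R) M : L2_martingale M ->
  measurable_fun setT (h : g_sigma_algebraType (G k) -> R) -> sq_integrable P h ->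
  \int[P]_x (h x * (M k.+1 x - M k x)) = 0.
Proof.
move=> mM mh hi; apply: (orthogonal_sub_sigma (@subG k)) => //.
  by apply: sq_integrableB; exact: L2m_sq.
exact: L2m_incr.
Qed.

Lemma transform_mean0 H M m : L2_martingale M -> adapted_seq H ->
  (forall k, sq_integrable P (H k)) -> \int[P]_x transform H M m x = 0.
Proof.
move=> mM aH iH; rewrite /transform Rintegral_sum => [|i].
  by rewrite big1// => i _; apply: orthogonal_increment.
by apply: sq_integrable_mul => //; apply: sq_integrableB; exact: L2m_sq.
Qed.

Lemma measurable_transform H M m : adapted_seq H -> adapted_seq M ->
  measurable_fun setT (transform H M m : g_sigma_algebraType (G m) -> R).
Proof.
move=> aH aM; rewrite /transform; elim: m => [|m ih].
  by under eq_fun do rewrite big_ord0; exact: measurable_cst.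
under eq_fun do rewrite big_ord_recr /=.
apply: measurable_funD; first exact: adaptedS.
apply: measurable_funM; first exact: adaptedS.
by apply: measurable_funB => //; exact: adaptedS.
Qed.

Lemma sq_integrable_transform H M m c : L2_martingale M -> adapted_seq H ->
  (forall k x, `|H k x| <= c) -> sq_integrable P (transform H M m).
Proof.
move=> mM aH Hc; rewrite /transform; elim: m => [|m ih].
  under eq_fun do rewrite big_ord0.
  by apply: (@sq_integrable_bounded _ _ _ _ 0) => // x; rewrite normr0.
under eq_fun do rewrite big_ord_recr /=.
apply: sq_integrableD => //; apply: (@sq_integrable_bounded_mul _ _ _ _ c) => //.
  by apply: sq_integrableB; exact: L2m_sq.
exact: (@adapted_measurable m).
Qed.

Lemma L2_martingale_sqrB M k : L2_martingale M ->
  \int[P]_x (M k.+1 x - M k x) ^+ 2 =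
  \int[P]_x (M k.+1 x ^+ 2) - \int[P]_x (M k x ^+ 2).
Proof.
move=> mM; have sM j := L2m_sq mM j.
have h := orthogonal_increment mM (@L2m_adapted _ mM k) (sM k).
have sD := sq_integrableB (sM k.+1) (sM k).
have -> : \int[P]_x (M k.+1 x - M k x) ^+ 2 =
    \int[P]_x ((M k.+1 x ^+ 2 - M k x ^+ 2) - 2 * (M k x * (M k.+1 x - M k x))).
  by apply: eq_Rintegral => x _; ring.
have i1 := (sM k.+1).2; have i2 := (sM k).2.
have i3 := sq_integrable_mul (sM k) sD.
have i4 := integrable_scaler 2 i3.
have i5 : P.-integrable setT (EFin \o (fun x => M k.+1 x ^+ 2 - M k x ^+ 2)).
  exact: (integrableB measurableT i1 i2).
by rewrite RintegralB// RintegralB// RintegralZl// h mulr0 subr0.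
Qed.

(** Cross terms vanish by orthogonality of increments and the means of the squared increments
    telescope. The bound involves only the two ends of the martingale, which makes it uniform over
    refinements of a partition. *)
Lemma transform_L2_bound H M m c : L2_martingale M -> adapted_seq H ->
  (forall k x, `|H k x| <= c) ->
  \int[P]_x (transform H M m x ^+ 2) <=
  c ^+ 2 * (\int[P]_x (M m x ^+ 2) - \int[P]_x (M 0 x ^+ 2)).
Proof.
move=> mM aH Hc; have sM j := L2m_sq mM j.
elim: m => [|m ih].
  rewrite subrr mulr0 /transform; under eq_Rintegral do rewrite big_ord0 expr0n.
  by rewrite Rintegral_cst// mul0r.
have sD := sq_integrableB (sM m.+1) (sM m).
have sS := sq_integrable_transform m mM aH Hc.
have mH : measurable_fun setT (H m) by exact: (@adapted_measurable m).
have sHD := sq_integrable_bounded_mul sD mH (Hc m).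
have sHS := sq_integrable_bounded_mul sS mH (Hc m).
have -> : \int[P]_x (transform H M m.+1 x ^+ 2) =
    \int[P]_x (transform H M m x ^+ 2 +
      (2 * ((H m x * transform H M m x) * (M m.+1 x - M m x)) +
       (H m x * (M m.+1 x - M m x)) ^+ 2)).
  by apply: eq_Rintegral => x _; rewrite /transform big_ord_recr/=; ring.
rewrite !RintegralD//; last 4 first.
- exact/integrable_scaler/sq_integrable_mul.
- exact: sHD.2.
- exact: sS.2.
- by apply: integrable_addr; [exact/integrable_scaler/sq_integrable_mul|exact: sHD.2].
rewrite RintegralZl//; last exact: sq_integrable_mul.
rewrite orthogonal_increment//; last first.
  by apply: measurable_funM => //; exact: measurable_transform (L2m_adapted mM).
rewrite mulr0 add0r.
have : \int[P]_x ((H m x * (M m.+1 x - M m x)) ^+ 2) <=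
    \int[P]_x (c ^+ 2 * (M m.+1 x - M m x) ^+ 2).
  apply: le_Rintegral => //; first exact: sHD.2.
    by apply: integrable_scaler; exact: sD.2.
  move=> x _; rewrite exprMn ler_wpM2r ?sqr_ge0// -(real_normK (num_real (H m x))).
  by rewrite lerXn2r ?nnegrE// (le_trans _ (Hc m x)).
rewrite RintegralZl//; last exact: sD.2.
rewrite L2_martingale_sqrB//.
move: ih; set a := c ^+ 2; nra.
Qed.

Lemma adapted_run_max M : adapted_seq M ->
  adapted_seq (fun k x => run_max (M^~ x) k).
Proof.
move=> aM; elim=> [|k ih] /=; first exact/measurableT_comp.
apply: measurable_maxr; first exact: adaptedS.
exact/measurableT_comp.
Qed.

Lemma sq_integrable_run_max M m : L2_martingale M ->
  sq_integrable P (fun x => run_max (M^~ x) m).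
Proof.
move=> mM; have mr k := adapted_measurable (@adapted_run_max _ (L2m_adapted mM) k).
have sn k : sq_integrable P (fun x => `|M k x|).
  apply: (sq_integrable_le _ (L2m_sq mM k)) => [|x]; last by rewrite normr_id.
  by apply: measurableT_comp => //; exact: (L2m_sq mM k).1.
elim: m => [|m ih] /=; first exact: sn.
apply: (sq_integrable_le _ (sq_integrableD ih (sn m.+1))); first exact: (mr m.+1).
move=> x; rewrite ger0_norm; last exact: (run_max_ge0 (M^~ x) m.+1).
rewrite [leRHS]ger0_norm ?addr_ge0 ?run_max_ge0//=.
by rewrite ge_max lerDl lerDr normr_ge0 run_max_ge0.
Qed.

(** The mean of [trajectorial_doob]. The integrand of the transform is unbounded, but
    square-integrable, which is enough for the transform to have mean 0. *)
Lemma doob_L2 M m : L2_martingale M ->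
  \int[P]_x (run_max (M^~ x) m ^+ 2) <= 4 * \int[P]_x (M m x ^+ 2).
Proof.
move=> mM; pose H k x := run_max (M^~ x) k * sgn (M k x).
have aH : adapted_seq H.
  move=> k; apply: measurable_funM; first exact: adapted_run_max (L2m_adapted mM) k.
  apply: measurable_fun_ifT; [|exact: measurable_cst..].
  by apply: measurable_fun_ltr; [exact: (L2m_adapted mM)|exact: measurable_cst].
have sH k : sq_integrable P (H k).
  apply: (sq_integrable_le _ (sq_integrable_run_max k mM)).
    exact: adapted_measurable (aH k).
  by move=> x; rewrite normrM /sgn; case: ifP => _; rewrite ?normrN1 ?normr1 mulr1.
have sT : P.-integrable setT (EFin \o transform H M m).
  rewrite /transform.
  have := @integrable_sum _ _ _ P setT measurableT _ (index_enum 'I_m) xpredT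
    (fun k => EFin \o (fun x => H k x * (M k.+1 x - M k x))).
  move=> h; have {}h := h _; apply: eq_integrable (h _) => // [x _|k _].
    by rewrite /= sumEFin.
  by apply: sq_integrable_mul => //; apply: sq_integrableB; exact: L2m_sq.
rewrite -[leRHS]subr0 -(mulr0 4) -(transform_mean0 m mM aH sH).
have sM := (L2m_sq mM m).2.
rewrite -!RintegralZl// -RintegralB//; last 2 first.
- exact: integrable_scaler.
- exact: integrable_scaler.
apply: le_Rintegral => //.
- exact: (sq_integrable_run_max m mM).2.
- apply: (@integrable_addr _ _ _ _ _ (fun x => - (4 * transform H M m x))).
    exact: integrable_scaler.
  by under eq_fun do rewrite -mulNr; exact: integrable_scaler.
- by move=> x _; exact: trajectorial_doob.
Qed.

End discrete_martingale.

(** * Passage to the limit in means *)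

Section uniform_integrability.
Context d (T : measurableType d) (R : realType) (P : probability T R).
Implicit Types f g h : T -> R.

(** Replacing g by max (f, g), equal to g almost everywhere, restores a comparison at every
    point. *)
Lemma ae_le_Rintegral f g : P.-integrable setT (EFin \o f) ->
  P.-integrable setT (EFin \o g) -> {ae P, forall x, f x <= g x} ->
  \int[P]_x f x <= \int[P]_x g x.
Proof.
move=> fi gi fg.
have mf : measurable_fun setT f by apply/measurable_EFinP; exact: measurable_int fi.
have mg : measurable_fun setT g by apply/measurable_EFinP; exact: measurable_int gi.
have mM : measurable_fun setT (fun x => Num.max (f x) (g x)) by exact: measurable_maxr.
have -> : \int[P]_x g x = \int[P]_x Num.max (f x) (g x).
  congr fine; apply: ae_eq_integral => //; try exact/measurable_EFinP.
  by apply: filterS fg => x h _; rewrite (max_idPr h).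
apply: le_Rintegral => // [|x _]; last by rewrite le_max lexx.
apply: (dom_integrable mM (integrable_addr (integrable_norm fi) (integrable_norm gi))).
move=> x /=; rewrite /Num.max; case: ifP => _; [rewrite lerDr|rewrite lerDl]; exact: normr_ge0.
Qed.

(** By monotone convergence the limit has integral at most c, hence is finite almost everywhere. D
    is its finite part, equal to 0 where the limit is infinite; there the domination may fail,
    whence the almost everywhere. *)
Lemma monotone_L1_dominated (a : nat -> T -> R) c :
  (forall n, P.-integrable setT (EFin \o a n)) -> (forall n x, 0 <= a n x) ->
  (forall n x, a n x <= a n.+1 x) -> (forall n, \int[P]_x a n x <= c) ->
  exists D : T -> R, [/\ P.-integrable setT (EFin \o D), forall x, 0 <= D x &
    {ae P, forall x n, a n x <= D x}].
Proof.
move=> ia a0 nda ac.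
have ma n : measurable_fun setT (EFin \o a n) by exact: measurable_int (ia n).
have nd x : {homo (fun n => (a n x)%:E) : m n / (m <= n)%N >-> (m <= n)%E}.
  by apply/nondecreasing_seqP => n; rewrite lee_fin.
pose F x := limn (fun n => (a n x)%:E).
have mF : measurable_fun setT F.
  have := @measurable_fun_limn_esup _ _ _ setT (fun n => EFin \o a n) ma.
  congr (measurable_fun _ _); apply/funext => x.
  rewrite is_cvg_limn_esupE //.
  by apply: ereal_nondecreasing_is_cvgn; exact: (nd x).
have aF n x : ((a n x)%:E <= F x)%E.
  rewrite /F (cvg_lim _ (ereal_nondecreasing_cvgn (nd x)))//.
  by apply: ereal_sup_ubound; exists n.
have F0 x : (0 <= F x)%E by apply: le_trans (aF 0 x); rewrite lee_fin.
have Fi : P.-integrable setT F.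
  apply/integrableP; split=> //; apply: (@le_lt_trans _ _ c%:E); last exact: ltry.
  under eq_integral do rewrite gee0_abs//.
  rewrite (@monotone_convergence _ _ _ P setT measurableT (fun n => EFin \o a n))//; last 2 first.
  - by move=> n x _; rewrite lee_fin.
  - by move=> x _; exact: nd.
  apply: lime_le.
    apply: ereal_nondecreasing_is_cvgn => m n mn.
    by apply: ge0_le_integral => // x _; [rewrite lee_fin|exact: (nd x)].
  apply: nearW => n; have := ac n; rewrite -lee_fin fineK//.
  by apply: integrable_fin_num => //; exact: ia.
have fF : {ae P, forall x, F x \is a fin_num}.
  by apply: filterS (integrable_ae measurableT Fi) => x; apply.
exists (fine \o F); split.
- apply: le_integrable Fi => //; first by apply/measurable_EFinP; exact: measurableT_comp.
  move=> x _ /=; case: (F x) => [r| |] //=; rewrite ?normr0 ?leey//.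
- by move=> x /=; rewrite fine_ge0.
- by apply: filterS fF => x Fx n /=; rewrite -lee_fin fineK.
Qed.

(* A bound in L^2 on h and a domination of g make f = g + h uniformly
   integrable: |f| <= min (|f|, D + r) + h^2 / r. *)
Lemma cvg_mean0 (f g h : nat -> T -> R) (D : T -> R) c :
  (forall n x, f n x = g n x + h n x) ->
  (forall n, P.-integrable setT (EFin \o f n)) ->
  (forall n, sq_integrable P (h n)) ->
  (forall n, \int[P]_x (h n x ^+ 2) <= c) ->
  P.-integrable setT (EFin \o D) -> (forall x, 0 <= D x) ->
  {ae P, forall x n, `|g n x| <= D x} ->
  {ae P, forall x, f n x @[n --> \oo] --> 0} ->
  \int[P]_x f n x @[n --> \oo] --> 0.
Proof.
move=> fE fi hi hc Di D0 gD f0.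
have mf n : measurable_fun setT (f n) by apply/measurable_EFinP; exact: measurable_int (fi n).
have mD : measurable_fun setT D by apply/measurable_EFinP; exact: measurable_int Di.
have c0 : 0 <= c.
  apply: le_trans (hc 0); apply: Rintegral_ge0 => x _; exact: sqr_ge0.
have DRi r : P.-integrable setT (EFin \o (fun x => D x + r)).
  by apply: integrable_addr => //; exact: integrable_cstr.
pose k r n x := Num.min `|f n x| (D x + r).
have mk r n : measurable_fun setT (k r n).
  apply: measurable_minr; first exact: measurableT_comp.
  exact: measurable_funD.
have kD r n x : 0 <= r -> `|k r n x| <= D x + r.
  move=> r0; rewrite ger0_norm ?ge_min ?lexx ?orbT// le_min normr_ge0/=.
  by rewrite addr_ge0.
have kcv r : 0 < r -> \int[P]_x k r n x @[n --> \oo] --> 0.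
  move=> r0; rewrite -[X in _ --> X](_ : \int[P]_x (fun=> 0) x = 0); last first.
    by rewrite Rintegral_cst// mul0r.
  apply: (@Rdominated_cvg _ _ _ _ _ _ (fun x => D x + r)) => //.
    apply: filterS f0 => x fx.
    apply: (@squeeze_cvgr _ _ _ _ (fun=> 0) (fun n => `|f n x|)) => //.
    - apply: nearW => n; rewrite le_min normr_ge0 addr_ge0 ?(ltW r0)//=.
      by rewrite /k ge_min lexx.
    - exact: cvg_cst.
    - by rewrite -(normr0 R); apply: cvg_norm.
  by move=> x n; rewrite kD// ltW.
apply/cvgr0Pnorm_le => e e0.
(* Chosen so that c / r <= e / 2; c + 1 instead of c keeps r positive when c = 0. *)
pose r := 2 * (c + 1) / e.
have r0 : 0 < r by rewrite /r divr_gt0// mulr_gt0// ltr_wpDl.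
have e20 : 0 < e / 2 by rewrite divr_gt0.
have /cvgr0Pnorm_le/(_ _ e20) := kcv _ r0.
apply: filterS => n kn.
apply: le_trans (le_normr_Rintegral measurableT (fi n)) _.
have ki : P.-integrable setT (EFin \o k r n).
  by apply: (dom_integrable (mk r n) (DRi r)) => x; rewrite kD// ltW.
have hi2 : P.-integrable setT (EFin \o (fun x => r^-1 * h n x ^+ 2)).
  by apply: integrable_scaler; exact: (hi n).2.
apply: (@le_trans _ _ (\int[P]_x (k r n x + r^-1 * h n x ^+ 2))).
  apply: ae_le_Rintegral; [exact: integrable_norm|exact: integrable_addr|].
  apply: filterS gD => x /(_ n) gx.
  rewrite /k minEle; case: ifPn => [_|].
    by rewrite lerDl mulr_ge0 ?sqr_ge0// invr_ge0 ltW.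
  (* Here |f| > D + r while |f| <= D + |h|, so |h| > r and therefore |h| <= h^2 / r. *)
  rewrite -ltNge => fD.
  have h1 : `|f n x| <= D x + `|h n x|.
    by rewrite fE (le_trans (ler_normD _ _))// lerD2r.
  have h2 : r < `|h n x| by rewrite -(ltrD2l (D x)) (lt_le_trans fD).
  apply: (le_trans h1); rewrite -addrA lerD2l.
  suff : `|h n x| <= r^-1 * h n x ^+ 2 by move=> ?; rewrite ler_wpDl// ltW.
  rewrite -(real_normK (num_real (h n x))) ler_pdivlMl// expr2.
  by rewrite ler_wpM2r// ltW.
rewrite RintegralD// RintegralZl//; last exact: (hi n).2.
rewrite (splitr e) lerD//.
  by rewrite (le_trans _ kn)// ler_norm.
rewrite ler_pdivrMl// /r.
apply: (le_trans (hc n)).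
have -> : 2 * (c + 1) / e * (e / 2) = c + 1 by field; rewrite gt_eqF.
by rewrite lerDl.
Qed.

End uniform_integrability.

(** * The compensator of a squared martingale *)

Section compensator.
Context d (T : measurableType d) (R : realType) (P : probability T R).
Variable G : R -> set (set T).
Hypothesis subG : forall t, <<s G t >> `<=` measurable.
Hypothesis incG : forall s t, s <= t -> <<s G s >> `<=` <<s G t >>.

Record L2_martingale_R (M : R -> T -> R) : Prop := {
  L2r_adapted : forall t : R, 0 <= t ->
    measurable_fun setT (M t : g_sigma_algebraType (G t) -> R);
  L2r_sq : forall t : R, 0 <= t -> sq_integrable P (M t);
  L2r_incr : forall (s t : R) B, 0 <= s <= t -> <<s G s >> B ->
    \int[P]_x (\1_B x * (M t x - M s x)) = 0 }.

Definition dyadic (s t : R) n k : R := s + (t - s) * (k%:R / (2 ^ n)%:R).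

Lemma dyadic0 s t n : dyadic s t n 0 = s.
Proof. by rewrite /dyadic mul0r mulr0 addr0. Qed.

Lemma dyadic_last s t n : dyadic s t n (2 ^ n) = t.
Proof. by rewrite /dyadic divff ?pnatr_eq0 ?expn_eq0// mulr1 addrC subrK. Qed.

(** The partitions are nested, so that the running maxima over them increase with n and have a
    common majorant. *)
Lemma dyadic_double s t n k : dyadic s t n.+1 (2 * k) = dyadic s t n k.
Proof.
rewrite /dyadic expnS !natrM; congr (_ + _ * _).
by field; rewrite pnatr_eq0 expn_eq0.
Qed.

Lemma dyadic_le s t n j k : s <= t -> (j <= k)%N -> dyadic s t n j <= dyadic s t n k.
Proof.
move=> st jk; rewrite lerD2l ler_wpM2l ?subr_ge0// ler_pM2r ?ler_nat//.
Qed.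

Lemma dyadic_ge s t n k : s <= t -> s <= dyadic s t n k.
Proof. by move=> st; rewrite -[leLHS](dyadic0 s t n) dyadic_le. Qed.

Variables (M N U Q : R -> T -> R) (s t K C : R).
Hypothesis st : 0 <= s <= t.
Hypothesis mM : L2_martingale_R M.
Hypothesis mN : L2_martingale_R N.
Hypothesis mU : forall r : R, 0 <= r ->
  measurable_fun setT (U r : g_sigma_algebraType (G r) -> R).
Hypothesis U_K : forall r x, `|U r x| <= K.
Hypothesis mQ : forall r : R, 0 <= r -> measurable_fun setT (Q r).
Hypothesis Q_C : forall r x, 0 <= r <= t -> `|Q r x| <= C.

Let p := dyadic s t.

(* r_k in the notation of the header, with the increment of V eliminated *)
Definition remainder n k x :=
  (M (p n k.+1) x ^+ 2 - Q (p n k.+1) x) - (M (p n k) x ^+ 2 - Q (p n k) x)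
  - (N (p n k.+1) x - N (p n k) x)
  - 2 * (M (p n k) x - U (p n k) x) * (M (p n k.+1) x - M (p n k) x).

Hypothesis remainder0 :
  {ae P, forall x, \sum_(k < 2 ^ n) `|remainder n k x| @[n --> \oo] --> 0}.

Let s0 : 0 <= s.
Proof. by case/andP: st. Qed.
Let s_le_t : s <= t.
Proof. by case/andP: st. Qed.
Let p0 n k : 0 <= p n k.
Proof. exact: le_trans s0 (dyadic_ge _ _ s_le_t). Qed.
Let pS n k : p n k <= p n k.+1.
Proof. exact: dyadic_le. Qed.
Let p_le_t n k : (k <= 2 ^ n)%N -> p n k <= t.
Proof. by move=> kn; rewrite -[leRHS](dyadic_last s t n) dyadic_le. Qed.

Let Gp n k := G (p n k).
Let subGp n k : <<s Gp n k >> `<=` measurable.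
Proof. exact: subG. Qed.
Let incGp n k : <<s Gp n k >> `<=` <<s Gp n k.+1 >>.
Proof. by apply: incG; exact: pS. Qed.

Let discrete L n : L2_martingale_R L -> L2_martingale P (Gp n) (fun k => L (p n k)).
Proof.
move=> mL; split.
- by move=> k; exact: L2r_adapted.
- by move=> k; exact: L2r_sq.
- by move=> k B GB; apply: L2r_incr => //; rewrite p0 pS.
Qed.

Let top n x := run_max (fun k => M (p n k) x) (2 ^ n).

(** Doob's inequality bounds the means of the squared maxima by 4 E M_t^2 for every grid, and the
    maxima increase with the grid. Only values at dyadic times are dominated, so no path regularity
    of [M] is involved. *)
Let dominate : exists D : T -> R, [/\ P.-integrable setT (EFin \o D),
  forall x, 0 <= D x & {ae P, forall x n, top n x ^+ 2 <= D x}].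
Proof.
apply: (@monotone_L1_dominated _ _ _ _ (fun n x => top n x ^+ 2)
  (4 * \int[P]_x (M t x ^+ 2))).
- by move=> n; exact: (sq_integrable_run_max (@subGp n) (@incGp n) _ (discrete n mM)).2.
- by move=> n x; exact: sqr_ge0.
- move=> n x; rewrite lerXn2r ?nnegrE ?run_max_ge0//.
  apply/run_max_le => k kn; 
  have -> : p n k = p n.+1 (2 * k) by rewrite /p dyadic_double.
  have /run_max_le := lexx (top n.+1 x); apply.
  by rewrite expnS leq_mul2l.
- move=> n; have := doob_L2 (@subGp n) (@incGp n) (2 ^ n) (discrete n mM).
  by rewrite /p dyadic_last.
Qed.

Variable B : set T.
Hypothesis GB : <<s G s >> B.

(** The maximum in [I] includes the left endpoint of the k-th step and excludes the right one: the
    weight is known before the increment, and |M| <= c there, so the integrand [J] is bounded by 2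
    (c + K). Since [B] lies in the past of s, the factor \1_B keeps the integrands adapted. *)
Let Phi r x := M r x ^+ 2 - Q r x.
Let I c n k x : bool := run_max (fun k => M (p n k) x) k <= c.
Let H c n k x : R := \1_B x * (if I c n k x then 1 else 0).
Let J c n k x : R := H c n k x * (2 * (M (p n k) x - U (p n k) x)).

Let indic_le1 x : `|\1_B x : R| <= 1.
Proof. by rewrite indicE; case: (_ \in _); rewrite ?normr1 ?normr0. Qed.

Let H_le1 c n k x : `|H c n k x| <= 1.
Proof.
by rewrite normrM -[leRHS]mul1r ler_pM//; case: ifP; rewrite ?normr1 ?normr0.
Qed.

Let GpB n k : <<s Gp n k >> B.
Proof. by apply: incG GB; exact: dyadic_ge. Qed.

Let aH c n : adapted_seq (Gp n) (H c n).
Proof.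
move=> k; apply: measurable_funM; first by apply: measurable_indic; exact: GpB.
apply: measurable_fun_ifT; [|exact: measurable_cst..].
apply: measurable_fun_ler; last exact: measurable_cst.
exact: (adapted_run_max (@incGp n) (L2m_adapted (discrete n mM))).
Qed.

Let aJ c n : adapted_seq (Gp n) (J c n).
Proof.
move=> k; apply: measurable_funM; first exact: aH.
apply: measurable_funM; first exact: measurable_cst.
by apply: measurable_funB; [exact: L2r_adapted|exact: mU].
Qed.

Let K0 (x : T) : 0 <= K.
Proof. exact: le_trans (normr_ge0 _) (U_K 0 x). Qed.
Let C0 (x : T) : 0 <= C.
Proof. by apply: le_trans (normr_ge0 _) (@Q_C 0 x _); rewrite lexx (le_trans s0). Qed.

Let J_le c n k x : 0 <= c -> `|J c n k x| <= 2 * (c + K).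
Proof.
move=> c0; rewrite /J /H; case: ifPn => [Ik|_]; last first.
  by rewrite mulr0 mul0r normr0 mulr_ge0// addr_ge0// (K0 x).
rewrite mulr1 normrM -[leRHS]mul1r ler_pM// normrM ger0_norm// ler_wpM2l//.
apply: (le_trans (ler_normB _ _)); rewrite lerD//.
exact: le_trans (norm_le_run_max (fun k => M (p n k) x) k) Ik.
Qed.

(** In the application of [cvg_mean0], [S] is the dominated part, [V] the part bounded in L^2 and
    [E] = [S] + [V] the sum that tends to 0 pointwise almost everywhere. This [V] consists of
    martingale transforms and is not the finite-variation process of the overview. *)
Let S c n x := \sum_(k < 2 ^ n) H c n k x * (Phi (p n k.+1) x - Phi (p n k) x).
Let E c n x := \sum_(k < 2 ^ n) H c n k x * remainder n k x.
Let V c n x := - (transform (H c n) (fun k => N (p n k)) (2 ^ n) x +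
                  transform (J c n) (fun k => M (p n k)) (2 ^ n) x).

Let E_split c n x : E c n x = S c n x + V c n x.
Proof.
rewrite /E /V /transform -big_split/= -sumrN -big_split/=.
by apply: eq_bigr => k _; rewrite /remainder /J /Phi; ring.
Qed.

Let V_sq c n : 0 <= c -> sq_integrable P (V c n).
Proof.
move=> c0; apply: sq_integrableN; apply: sq_integrableD.
  exact: (sq_integrable_transform (@subGp n) _ (discrete n mN) (@aH c n) (H_le1 c n)).
apply: (sq_integrable_transform (@subGp n) _ (discrete n mM) (@aJ c n)).
by move=> k x; exact: J_le.
Qed.

(** From (a + b)^2 <= 2 a^2 + 2 b^2 and the transform bound with |H| <= 1 and |J| <= 2 (c + K). All
    grids end at t, hence a bound independent of n. *)
Let V_bound c : 0 <= c -> exists b, forall n, \int[P]_x (V c n x ^+ 2) <= b.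
Proof.
move=> c0; exists (2 * (1 ^+ 2 * \int[P]_x (N t x ^+ 2) +
                   (2 * (c + K)) ^+ 2 * \int[P]_x (M t x ^+ 2))) => n.
have i1 := sq_integrable_transform (@subGp n) (2 ^ n) (discrete n mN) (@aH c n) (H_le1 c n).
have J2 k x : `|J c n k x| <= 2 * (c + K) by exact: J_le.
have i2 := sq_integrable_transform (@subGp n) (2 ^ n) (discrete n mM) (@aJ c n) J2.
have b1 := transform_L2_bound (@subGp n) (@incGp n) (2 ^ n) (discrete n mN) (@aH c n) (H_le1 c n).
have b2 := transform_L2_bound (@subGp n) (@incGp n) (2 ^ n) (discrete n mM) (@aJ c n) J2.
rewrite /p dyadic_last in b1 b2.
apply: (@le_trans _ _ (\int[P]_x (2 *
  (transform (H c n) (fun k => N (p n k)) (2 ^ n) x ^+ 2 +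
   transform (J c n) (fun k => M (p n k)) (2 ^ n) x ^+ 2)))).
  apply: le_Rintegral => //; first exact: (V_sq n c0).2.
    by apply: integrable_scaler; apply: integrable_addr; [exact: i1.2|exact: i2.2].
  move=> x _; rewrite /V sqrrN; set a := transform _ _ _ _; set b := transform _ _ _ _.
  by have := sqr_ge0 (a - b); nra.
rewrite RintegralZl//; last by apply: integrable_addr; [exact: i1.2|exact: i2.2].
rewrite ler_pM2l// RintegralD//; [|exact: i1.2|exact: i2.2].
rewrite lerD//.
  apply: (le_trans b1); rewrite ler_wpM2l// lerBlDr lerDl.
  by apply: Rintegral_ge0 => x _; exact: sqr_ge0.
apply: (le_trans b2); rewrite ler_wpM2l ?sqr_ge0// lerBlDr lerDl.
by apply: Rintegral_ge0 => x _; exact: sqr_ge0.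
Qed.

Let V_mean0 c n : 0 <= c -> \int[P]_x V c n x = 0.
Proof.
move=> c0.
have i1 := sq_integrable_transform (@subGp n) (2 ^ n) (discrete n mN) (@aH c n) (H_le1 c n).
have J2 k x : `|J c n k x| <= 2 * (c + K) by exact: J_le.
have i2 := sq_integrable_transform (@subGp n) (2 ^ n) (discrete n mM) (@aJ c n) J2.
have iD := sq_integrableD i1 i2.
rewrite /V; under eq_Rintegral do rewrite -mulN1r.
rewrite RintegralZl//; last exact: sq_integrable_int.
rewrite RintegralD//; [|exact: sq_integrable_int..].
rewrite (transform_mean0 (@subGp n) _ (discrete n mN) (@aH c n)) => [|k].
  rewrite (transform_mean0 (@subGp n) _ (discrete n mM) (@aJ c n)) ?addr0 ?mulr0// => k.
  apply: sq_integrable_bounded (J2 k); exact: (sub_sigma_measurable_fun (@subGp n k) (@aJ c n k)).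
apply: sq_integrable_bounded (H_le1 c n k).
exact: (sub_sigma_measurable_fun (@subGp n k) (@aH c n k)).
Qed.

Let S_telescope c n x : exists2 j, (j <= 2 ^ n)%N &
  (top n x <= c -> j = (2 ^ n)%N) /\ S c n x = \1_B x * (Phi (p n j) x - Phi s x).
Proof.
have [|j jn [jI jE]] := @stopped_telescope R (fun _ => 0) (fun k => I c n k x) (2 ^ n).
  by move=> k; rewrite /I /= ge_max => /andP[].
exists j => //; split=> [tc|].
  apply: jI => k kn; rewrite /I; apply/run_max_le => i ik.
  by have /run_max_le := tc; apply; rewrite (leq_trans ik)// ltnW.
have := jE (fun k => Phi (p n k) x); rewrite /p dyadic0 => <-.
by rewrite /S big_distrr/=; apply: eq_bigr => k _; rewrite /H mulrA.
Qed.

Let Phi_le D n j x : (forall n, top n x ^+ 2 <= D) -> (j <= 2 ^ n)%N ->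
  `|\1_B x * (Phi (p n j) x - Phi s x)| <= 2 * (D + C).
Proof.
move=> tD jn.
have M_D k : (k <= 2 ^ n)%N -> `|Phi (p n k) x| <= D + C.
  move=> kn; apply: (le_trans (ler_normB _ _)); rewrite lerD//; last first.
    by apply: Q_C; rewrite p0 p_le_t.
  rewrite ger0_norm ?sqr_ge0// (le_trans _ (tD n))//.
  rewrite -(real_normK (num_real (M _ x))) lerXn2r ?nnegrE ?run_max_ge0//.
  by have /run_max_le := lexx (top n x); apply.
rewrite normrM -[leRHS]mul1r ler_pM// (le_trans (ler_normB _ _))//.
rewrite mulr_natl mulr2n lerD//; first exact: M_D.
by have := M_D 0%N (leq0n _); rewrite /p dyadic0.
Qed.

Let Phi_integrable r : 0 <= r <= t -> P.-integrable setT (EFin \o Phi r).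
Proof.
move=> /andP[r0 rt]; apply: (@integrable_addr _ _ _ _ _ (fun x => - Q r x)).
  exact: (L2r_sq mM r0).2.
apply: sq_integrable_int; apply: sq_integrableN; apply: (@sq_integrable_bounded _ _ _ _ C).
  exact: mQ.
by move=> x; apply: Q_C; rewrite r0.
Qed.

Let dPhi_integrable c n k : (k < 2 ^ n)%N -> P.-integrable setT
  (EFin \o (fun x => H c n k x * (Phi (p n k.+1) x - Phi (p n k) x))).
Proof.
move=> kn.
have mH := sub_sigma_measurable_fun (@subGp n k) (@aH c n k).
have i1 : P.-integrable setT
    (EFin \o (fun x => Phi (p n k.+1) x - Phi (p n k) x)).
  have i1 := @Phi_integrable (p n k.+1); have i2 := @Phi_integrable (p n k).
  apply: (integrableB measurableT (i1 _) (i2 _)); rewrite p0 p_le_t//.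
  exact: ltnW.
have m1 : measurable_fun setT (fun x => Phi (p n k.+1) x - Phi (p n k) x).
  by apply/measurable_EFinP; exact: measurable_int i1.
apply: (dom_integrable _ (integrable_norm i1)); first exact: measurable_funM.
by move=> x; rewrite normrM -[leRHS]mul1r ler_pM.
Qed.

Let S_integrable c n : P.-integrable setT (EFin \o S c n).
Proof.
have := @integrable_sum _ _ _ P setT measurableT _ (index_enum 'I_(2 ^ n)) xpredT
    (fun k => EFin \o (fun x => H c n k x * (Phi (p n k.+1) x - Phi (p n k) x))).
move=> h; apply: eq_integrable (h _) => // [x _|k _]; first by rewrite /= sumEFin.
exact: dPhi_integrable.
Qed.

(** Since [V] has mean 0, [S] and [E] have the same mean. The telescoped form of [S] is bounded by 2
    (D + C), [V] is bounded in L^2, and |E| is at most the sum of the |remainder|, so [cvg_mean0]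
    applies. *)
Let E_mean0 c : 0 <= c -> \int[P]_x S c n x @[n --> \oo] --> 0.
Proof.
move=> c0; have [D [Di D0 tD]] := dominate; have [b Vb] := V_bound c0.
have iE n : P.-integrable setT (EFin \o E c n).
  rewrite (_ : E c n = fun x => S c n x + V c n x); last exact/funext/E_split.
  by apply: integrable_addr => //; apply: sq_integrable_int; exact: V_sq.
have -> : (fun n => \int[P]_x S c n x) = (fun n => \int[P]_x E c n x).
  apply/funext => n; under [RHS]eq_Rintegral do rewrite E_split.
  rewrite RintegralD// ?V_mean0 ?addr0//.
  by apply: sq_integrable_int; exact: V_sq.
apply: (@cvg_mean0 _ _ _ _ (E c) (S c) (V c) (fun x => 2 * (D x + `|C|)) b) => //.
- by move=> n; exact: V_sq.
- by apply: integrable_scaler; apply: integrable_addr => //; exact: integrable_cstr.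
- by move=> x; rewrite mulr_ge0// addr_ge0.
- apply: filterS tD => x tD n; have [j jn [_ ->]] := S_telescope c n x.
  by rewrite (ger0_norm (C0 x)); exact: Phi_le.
- apply: filterS remainder0 => x rx.
  apply/cvgr0Pnorm_le => e e0; move/cvgr0Pnorm_le/(_ _ e0): rx; apply: filterS => n.
  apply: le_trans; rewrite [leRHS]ger0_norm ?sumr_ge0//.
  apply: (le_trans (ler_norm_sum _ _ _)); apply: ler_sum => k _.
  by rewrite normrM -[leRHS]mul1r ler_wpM2r.
Qed.

(** The stopping is removed in two limits: n tends to infinity at fixed c, by [E_mean0], and then c
    does. The error made by stopping is at most [W c], whose mean tends to 0 by dominated
    convergence. *)
Lemma compensated_increment_mean0 :
  \int[P]_x (\1_B x * ((M t x ^+ 2 - Q t x) - (M s x ^+ 2 - Q s x))) = 0.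
Proof.
have [D [Di D0 tD]] := dominate.
pose Z x := \1_B x * (Phi t x - Phi s x).
(* If D x <= c^2 the maximum stays below c on every grid, nothing is stopped and [S] equals [Z].
   Otherwise [Z] and [S] are each at most 2 (D + C), which gives the factor 4. *)
pose W (c : nat) x : R := (if c%:R ^+ 2 < D x then 1 else 0) * (4 * (D x + `|C|)).
have mD : measurable_fun setT D by apply/measurable_EFinP; exact: measurable_int Di.
have iW0 : P.-integrable setT (EFin \o (fun x => 4 * (D x + `|C|))).
  by apply: integrable_scaler; apply: integrable_addr => //; exact: integrable_cstr.
have mW c : measurable_fun setT (W c).
  apply: measurable_funM; last by apply/measurable_EFinP; exact: measurable_int iW0.
  by apply: measurable_fun_ifT => //; exact: measurable_fun_ltr.
have W_le c x : `|W c x| <= 4 * (D x + `|C|).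
  have h : 0 <= 4 * (D x + `|C|) by rewrite mulr_ge0// addr_ge0.
  by rewrite /W; case: ifP => _; rewrite ?mul1r ?mul0r ?normr0// ger0_norm.
have iW c : P.-integrable setT (EFin \o W c) by exact: dom_integrable iW0 _.
have iZ : P.-integrable setT (EFin \o Z).
  have i1 : P.-integrable setT (EFin \o (fun x => Phi t x - Phi s x)).
    have i1 := @Phi_integrable t; have i2 := @Phi_integrable s.
    by apply: (integrableB measurableT (i1 _) (i2 _)); rewrite ?lexx ?s_le_t ?s0 ?(le_trans s0).
  have m1 : measurable_fun setT (fun x => Phi t x - Phi s x).
    by apply/measurable_EFinP; exact: measurable_int i1.
  apply: (dom_integrable _ (integrable_norm i1)).
    by apply: measurable_funM => //; apply: measurable_indic; exact: subG GB.
  by move=> x; rewrite normrM -[leRHS]mul1r ler_pM.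
have ZS (c n : nat) : {ae P, forall x, `|Z x - S c%:R n x| <= W c x}.
  apply: filterS tD => x tD.
  have [j jn [jtop ->]] := S_telescope c%:R n x; rewrite /W; case: ifPn => [_|].
    have h1 := Phi_le tD jn; have h2 := Phi_le tD (leqnn (2 ^ n)).
    rewrite /p dyadic_last in h2.
    rewrite mul1r (le_trans (ler_normB _ _))// (le_trans (lerD h2 h1))//.
    have := ler_norm C; lra.
  rewrite -leNgt => Dc; rewrite jtop ?mul0r.
    by rewrite /Z /p dyadic_last subrr normr0.
  rewrite -(@ler_pXn2r _ 2) ?nnegrE ?run_max_ge0//.
  exact: le_trans (tD n) Dc.
have Zle (c : nat) : `|\int[P]_x Z x| <= \int[P]_x W c x.
  have h n : `|\int[P]_x Z x| <= \int[P]_x W c x + `|\int[P]_x S c%:R n x|.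
    have := subrK (\int[P]_x S c%:R n x) (\int[P]_x Z x).
    rewrite -RintegralB// => <-; rewrite (le_trans (ler_normD _ _))// lerD2r.
    have iD : P.-integrable setT (EFin \o (fun x => Z x - S c%:R n x)).
      exact: (integrableB measurableT iZ (S_integrable _ _)).
    rewrite (le_trans (le_normr_Rintegral measurableT iD))//.
    by apply: ae_le_Rintegral => //; exact: integrable_norm.
  have cv : \int[P]_x W c x + `|\int[P]_x S c%:R n x| @[n --> \oo] --> \int[P]_x W c x.
    rewrite -[X in _ --> X]addr0 -(normr0 R); apply: cvgD; first exact: cvg_cst.
    by apply: cvg_norm; exact: E_mean0.
  rewrite -(cvg_lim _ cv)//; apply: limr_ge; first by apply/cvg_ex; eexists; exact: cv.
  by apply: nearW => n; exact: h.
have W0 : \int[P]_x W c x @[c --> \oo] --> 0.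
  rewrite -[X in _ --> X](_ : \int[P]_x (fun=> 0) x = 0); last first.
    by rewrite Rintegral_cst// mul0r.
  apply: (Rdominated_cvg mW _ _ iW0) => //; apply: aeW => x.
  apply: cvg_near_cst; near=> c; rewrite /W ifF ?mul0r//; apply/negbTE.
  (* For large c one has D x <= c <= c^2, so [W c x] is eventually 0. *)
  rewrite -leNgt (@le_trans _ _ c%:R)//; first by near: c; exact: nbhs_infty_ger.
  by near: c; exists 1%N => // c /= c1; rewrite expr2 ler_peMl// ler1n.
apply/eqP; rewrite -normr_le0.
rewrite -(cvg_lim _ W0)//; apply: limr_ge; first by apply/cvg_ex; eexists; exact: W0.
by apply: nearW => c; exact: Zle.
Unshelve. all: by end_near. Qed.

End compensator.

(** * Squares of functions in C^2_c(E_1) *)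

Section Ck.
Context (R : realType) (d : nat).
Local Notation E := 'rV[R]_d.
Implicit Types (U : set E) (f g : E -> R).

Lemma open_near_eq U f g x : open U -> (forall y, U y -> f y = g y) -> U x ->
  \forall y \near x, f y = g y.
Proof. by move=> oU fg Ux; apply: filterS fg _; exact: open_nbhs_nbhs. Qed.

Lemma eq_Ck_on U k f g : open U -> (forall x, U x -> f x = g x) ->
  Ck_on U k f -> Ck_on U k g.
Proof.
move=> oU; elim: k f g => [|k ih] f g fg [cf df]; split.
- move=> x Ux; have fgx := open_near_eq oU fg Ux.
  suff : g y @[y --> x] --> g x by [].
  rewrite -(fg x Ux); apply: cvg_trans (cf x Ux).
  exact: (near_eq_cvg fgx).
- by [].
- move=> x Ux; have fgx := open_near_eq oU fg Ux.
  suff : g y @[y --> x] --> g x by [].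
  rewrite -(fg x Ux); apply: cvg_trans (cf x Ux).
  exact: (near_eq_cvg fgx).
- move=> i; have [di Ci] := df i; split.
    move=> x Ux; apply: near_eq_derivable (di x Ux); exact: open_near_eq Ux.
  apply: ih Ci => x Ux; apply: near_eq_derive; exact: open_near_eq Ux.
Qed.

Lemma Ck_onW U k f : Ck_on U k.+1 f -> Ck_on U k f.
Proof.
elim: k f => [|k ih] f [cf df]; split=> // i.
have [di Ci] := df i; split=> //; exact: ih.
Qed.

Lemma Ck_onD U k f g : open U -> Ck_on U k f -> Ck_on U k g ->
  Ck_on U k (fun x => f x + g x).
Proof.
move=> oU; elim: k f g => [|k ih] f g [cf df] [cg dg]; split=> //.
- by move=> x Ux; exact: (cvgD (cf x Ux) (cg x Ux)).
- by move=> x Ux; exact: (cvgD (cf x Ux) (cg x Ux)).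
move=> i; have [fi Cfi] := df i; have [gi Cgi] := dg i; split.
  by move=> x Ux; apply: derivableD; [exact: fi|exact: gi].
apply: eq_Ck_on (ih _ _ Cfi Cgi) => // x Ux.
by rewrite /partial -deriveD//; [exact: fi|exact: gi].
Qed.

Lemma partialM i f g x : derivable f x (delta_mx 0 i) -> derivable g x (delta_mx 0 i) ->
  partial i (fun y => f y * g y) x = f x * partial i g x + g x * partial i f x.
Proof. by move=> fi gi; rewrite /partial (deriveM fi gi). Qed.

Lemma Ck_onM U k f g : open U -> Ck_on U k f -> Ck_on U k g ->
  Ck_on U k (fun x => f x * g x).
Proof.
move=> oU; elim: k f g => [|k ih] f g Cf Cg.
  by split=> // x Ux; exact: (cvgM (Cf.1 x Ux) (Cg.1 x Ux)).
have Cf' := Ck_onW Cf; have Cg' := Ck_onW Cg.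
case: Cf Cg => [cf df] [cg dg]; split.
  by move=> x Ux; exact: (cvgM (cf x Ux) (cg x Ux)).
move=> i; have [fi Cfi] := df i; have [gi Cgi] := dg i; split.
  by move=> x Ux; apply: derivableM; [exact: fi|exact: gi].
apply: (@eq_Ck_on _ _ (fun x => f x * partial i g x + g x * partial i f x)) => //.
  by move=> x Ux; rewrite partialM//; [exact: fi|exact: gi].
by apply: Ck_onD => //; exact: ih.
Qed.

End Ck.

Section coefficients.
Context (R : realType) (d : nat).
Local Notation E := 'rV[R]_d.
Variables (Omega : set E) (rho : E -> R) (Gamma2 : set E).
Hypothesis oO : open Omega.
Hypothesis G2cl : Gamma2 `<=` closure Omega.
Hypothesis crho : {within closure Omega, continuous rho}.
Let U := Omega `&` positive_rho rho.
Let F := E1 Omega rho Gamma2.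
Implicit Types f g u : E -> R.

Let O_cl : Omega `<=` closure Omega.
Proof. exact: subset_closure. Qed.

Lemma E1_closure : F `<=` closure Omega.
Proof. by move=> x [[/O_cl|/G2cl]]. Qed.

(** [ext_val] takes limits along Omega, whereas [C2c] controls derivatives only where rho > 0. By
    continuity of rho on the closure the two domains coincide near each point of [F], boundary
    points included. *)
Lemma near_E1_positive x : F x -> \forall y \near within Omega (nbhs x), U y.
Proof.
move=> Fx; have /subspace_continuousP/(_ x (E1_closure Fx)) := crho.
have rx : 0 < rho x by case: Fx.
move=> /cvgr_gt/(_ _ rx); rewrite !near_withinE; apply: filterS => y h Oy.
by split=> //; apply: h; exact: O_cl.
Qed.

Lemma open_positive : open U.
Proof.
rewrite openE => x [Ox rx]; have Fx : F x by split=> //; left.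
have := near_E1_positive Fx; rewrite near_withinE => h.
by near=> y; apply: (near h y) => //; near: y; exact: open_nbhs_nbhs.
Unshelve. all: by end_near. Qed.

Lemma positive_E1 : U `<=` F.
Proof. by move=> x [Ox rx]; split=> //; left. Qed.

Let within_proper x : F x -> ProperFilter (within Omega (nbhs x)).
Proof.
move=> /E1_closure clx; apply: Build_ProperFilter_ex => B.
rewrite /within/= => /clx [y [Oy h]]; exists y; exact: h.
Qed.

(** Limits along Omega at a point of [F] are unique, as [F] lies in the closure. All values of
    derivatives on Gamma2 are thereby reduced to some function continuous on [F]. *)
Lemma ext_valE f g x : (forall y, U y -> g y = f y) -> {within F, continuous g} ->
  F x -> ext_val Omega f x = g x.
Proof.
move=> gf cg Fx; have PF := within_proper Fx; apply: cvg_lim => //.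
have /subspace_continuousP/(_ x Fx) := cg => gx.
have h : (g y @[y --> within Omega (nbhs x)]) --> g x.
  move=> B /gx /=; rewrite /within/= => FB.
  have := near_E1_positive Fx; rewrite near_withinE => h.
  suff : nbhs x (fun y => Omega y -> B (g y)) by [].
  have k y : (F y -> B (g y)) -> (Omega y -> U y) -> Omega y -> B (g y).
    by move=> h1 h2 Oy; apply: h1; apply: positive_E1; exact: h2.
  exact: (@filterS2 _ (nbhs x) _ _ _ _ k FB h).
apply: cvg_trans h; apply: near_eq_cvg.
by apply: filterS (near_E1_positive Fx) => y Uy; rewrite gf.
Qed.

Lemma ext_val_near0 f x : F x -> (\forall y \near x, f y = 0) -> ext_val Omega f x = 0.
Proof.
move=> Fx f0; have PF := within_proper Fx; apply: cvg_lim => //.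
by apply: cvg_near_cst; rewrite near_withinE; apply: filterS f0.
Qed.

Lemma continuous_withinM f g : {within F, continuous f} -> {within F, continuous g} ->
  {within F, continuous (fun x => f x * g x)}.
Proof. by move=> cf cg x; apply: cvgM; [exact: cf|exact: cg]. Qed.

Lemma continuous_withinD f g : {within F, continuous f} -> {within F, continuous g} ->
  {within F, continuous (fun x => f x + g x)}.
Proof. by move=> cf cg x; apply: cvgD; [exact: cf|exact: cg]. Qed.

Lemma continuous_within_sum n (f : 'I_n -> E -> R) :
  (forall i, {within F, continuous (f i)}) ->
  {within F, continuous (fun x => \sum_(i < n) f i x)}.
Proof.
elim: n f => [|n ih] f cf.
  by under eq_fun do rewrite big_ord0; move=> x; exact: cvg_cst.
under eq_fun do rewrite big_ord_recr /=.
by apply: continuous_withinD => //; apply: ih.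
Qed.

Variables (A : E -> 'M[R]_d) (drho n : E -> E) (u : E -> R).
Hypothesis uC2 : C2c Omega rho Gamma2 u.
Local Notation usq := (fun x => u x * u x).

Let du i x := ext_val Omega (partial i u) x.
Let ddu i j x := ext_val Omega (partial i (partial j u)) x.

Let duP i : {within F, continuous (du i)} /\ forall x, U x -> du i x = partial i u x.
Proof.
have [_ _ /(_ i)[g [cg gE]] _ _] := uC2.
have e x : F x -> du i x = g x by apply: ext_valE.
split=> [|x Ux]; last by rewrite e ?gE//; exact: positive_E1.
by apply: subspace_eq_continuous cg => x Fx; apply/esym/e; exact: set_mem.
Qed.

Let dduP i j : {within F, continuous (ddu i j)} /\
  forall x, U x -> ddu i j x = partial i (partial j u) x.
Proof.
have [_ _ _ /(_ i j)[g [cg gE]] _] := uC2.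
have e x : F x -> ddu i j x = g x by apply: ext_valE.
split=> [|x Ux]; last by rewrite e ?gE//; exact: positive_E1.
by apply: subspace_eq_continuous cg => x Fx; apply/esym/e; exact: set_mem.
Qed.

Let cu : {within F, continuous u}.
Proof. by case: uC2. Qed.

Let u_derivable i x : U x -> derivable u x (delta_mx 0 i).
Proof. by have [[_ /(_ i)[+ _]] _ _ _ _] := uC2; exact. Qed.

Let du_derivable i j x : U x -> derivable (partial j u) x (delta_mx 0 i).
Proof. by have [[_ /(_ j)[_ [_ /(_ i)[+ _]]]] _ _ _ _] := uC2; exact. Qed.

Let partial_sqr i x : U x -> partial i usq x = 2 * (u x * partial i u x).
Proof.
by move=> Ux; rewrite (partialM (@u_derivable i x Ux) (@u_derivable i x Ux)); ring.
Qed.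

Let partial2_sqr i j x : U x -> partial i (partial j usq) x =
  2 * (partial i u x * partial j u x + u x * partial i (partial j u) x).
Proof.
move=> Ux.
(* The first-order formula holds on the open set [U], hence near x, and may be differentiated
   there. *)
have -> : partial i (partial j usq) x =
    partial i (fun y => (u y + u y) * partial j u y) x.
  apply: near_eq_derive; apply: (@open_near_eq _ _ U) => //; first exact: open_positive.
  by move=> y Uy; rewrite partial_sqr//; ring.
have d2 : derivable (fun y => u y + u y) x (delta_mx 0 i).
  by apply: derivableD; exact: u_derivable.
rewrite (partialM d2 (@du_derivable i j x Ux)).
have -> : partial i (fun y => u y + u y) x = partial i u x + partial i u x.
  exact: (deriveD (@u_derivable i x Ux) (@u_derivable i x Ux)).
by move: (partial i u x) (partial j u x) (partial i (partial j u) x) => a b c; ring.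
Qed.

Let cst2 : {within F, continuous (fun _ : E => 2 : R)}.
Proof. by move=> x; exact: cvg_cst. Qed.

Lemma C2c_sqr : C2c Omega rho Gamma2 usq.
Proof.
have [Cu _ _ _ [K [cK KF u0]]] := uC2; split.
- by apply: Ck_onM => //; exact: open_positive.
- exact: continuous_withinM.
- move=> i; exists (fun x => 2 * (u x * du i x)); split.
    by do 2 apply: continuous_withinM => //; exact: (duP i).1.
  by move=> x Ux; rewrite (duP i).2// partial_sqr.
- move=> i j; exists (fun x => 2 * (du i x * du j x + u x * ddu i j x)); split.
    apply: continuous_withinM => //; apply: continuous_withinD.
      by apply: continuous_withinM; [exact: (duP i).1|exact: (duP j).1].
    by apply: continuous_withinM => //; exact: (dduP i j).1.
  by move=> x Ux; rewrite (duP i).2// (duP j).2// (dduP i j).2// partial2_sqr.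
- by exists K; split=> // x /u0 ->; rewrite mul0r.
Qed.

Let ext_partial_sqr i x : F x ->
  ext_val Omega (partial i usq) x = 2 * (u x * du i x).
Proof.
move=> Fx; apply: (@ext_valE _ (fun x => 2 * (u x * du i x))) => // [y Uy|].
  by rewrite (duP i).2// partial_sqr.
by do 2 apply: continuous_withinM => //; exact: (duP i).1.
Qed.

Let ext_partial2_sqr i j x : F x -> ext_val Omega (partial i (partial j usq)) x =
  2 * (du i x * du j x + u x * ddu i j x).
Proof.
move=> Fx; apply: (@ext_valE _ (fun x => 2 * (du i x * du j x + u x * ddu i j x))) => // [y Uy|].
  by rewrite (duP i).2// (duP j).2// (dduP i j).2// partial2_sqr.
apply: continuous_withinM => //; apply: continuous_withinD.
  by apply: continuous_withinM; [exact: (duP i).1|exact: (duP j).1].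
by apply: continuous_withinM => //; exact: (dduP i j).1.
Qed.

Definition carre_du_champ x := mxdot (A x) (ext_grad Omega u x) (ext_grad Omega u x).

Lemma carre_du_champE x :
  carre_du_champ x = \sum_i \sum_j A x i j * (du i x * du j x).
Proof.
rewrite /carre_du_champ /mxdot /dotp; apply: eq_bigr => i _.
rewrite !mxE big_distrl/=; apply: eq_bigr => j _.
rewrite !mxE -/(du i x) -/(du j x).
by move: (du i x) (du j x) => a b; ring.
Qed.

(** The first-order part acts on v^2 as a derivation, so the excess 2 sum a_ij g_i g_j comes from
    the second-order part alone. *)
Let Lhat_sqr_sum (a : 'M[R]_d) (b g : 'I_d -> R) (h : 'I_d -> 'I_d -> R) v :
  \sum_i \sum_j a i j * (2 * (g i * g j + v * h i j)) + \sum_j b j * (2 * (v * g j)) =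
  2 * (v * (\sum_i \sum_j a i j * h i j + \sum_j b j * g j)) +
  2 * \sum_i \sum_j a i j * (g i * g j).
Proof.
rewrite mulrDr mulrDr addrAC; congr (_ + _); last first.
  by rewrite !big_distrr/=; apply: eq_bigr => j _; ring.
rewrite !big_distrr/= -big_split/=; apply: eq_bigr => i _.
rewrite !big_distrr/= -big_split/=; apply: eq_bigr => j _.
ring.
Qed.

Lemma Lhat_sqr x : F x -> Lhat Omega A rho drho usq x =
  2 * (u x * Lhat Omega A rho drho u x) + 2 * carre_du_champ x.
Proof.
move=> Fx; rewrite carre_du_champE /Lhat -(Lhat_sqr_sum _ _ (du^~ x)).
congr (_ + _).
  apply: eq_bigr => i _; apply: eq_bigr => j _.
  exact: (congr1 ( *%R (A x i j)) (ext_partial2_sqr i j Fx)).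
apply: eq_bigr => j _; congr (_ * _); exact: (ext_partial_sqr j Fx).
Qed.

Lemma flux_sqr x : F x -> flux Omega A rho Gamma2 n usq x =
  2 * (u x * flux Omega A rho Gamma2 n u x).
Proof.
move=> Fx; rewrite /flux.
have -> : ext_grad Omega usq x = (2 * u x) *: ext_grad Omega u x.
  by apply/rowP => i; rewrite !mxE ext_partial_sqr// mulrA.
have -> : mxdot (A x) ((2 * u x) *: ext_grad Omega u x) (n x) =
    (2 * u x) * mxdot (A x) (ext_grad Omega u x) (n x).
  rewrite /mxdot -scalemxAl /dotp big_distrr/=; apply: eq_bigr => i _.
  by rewrite mxE mulrA.
by move: (mxdot _ _ _) => a; ring.
Qed.

Lemma carre_du_champ_continuous :
  (forall i j, {within closure Omega, continuous (fun x => A x i j)}) ->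
  {within F, continuous carre_du_champ}.
Proof.
move=> cA; rewrite (_ : carre_du_champ = fun x => \sum_i \sum_j A x i j * (du i x * du j x)).
  do 2 apply: continuous_within_sum => ?; apply: continuous_withinM.
    by apply: continuous_subspaceW (cA _ _); exact: E1_closure.
  by apply: continuous_withinM; [exact: (duP _).1|exact: (duP _).1].
by apply/funext => x; exact: carre_du_champE.
Qed.

(** K is closed, so u vanishes in a neighbourhood of x and so do its derivatives. Compact support is
    what makes the extension by 0 to the cemetery continuous. *)
Lemma carre_du_champ_out (K : set E) x : compact K -> (forall y, ~ K y -> u y = 0) ->
  F x -> ~ K x -> carre_du_champ x = 0.
Proof.
move=> cK u0 Fx Kx; rewrite carre_du_champE big1// => i _; rewrite big1// => j _.
have nK : \forall y \near x, ~ K y.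
  apply: open_nbhs_nbhs; split=> //.
  by apply: (@closed_openC _ K); apply: compact_closed => //; exact: norm_hausdorff.
rewrite {1}/du ext_val_near0 ?mul0r ?mulr0//.
apply: filterS (nbhs_interior nK) => y Ky.
rewrite /partial (@near_eq_derive _ _ _ _ (cst 0)) ?derive_cst//.
by apply: filterS Ky => z /u0.
Qed.

Lemma carre_du_champ_ge0 x : cond1 Omega A -> F x -> 0 <= carre_du_champ x.
Proof.
move=> c1 /E1_closure clx; have [_ [g [g0 gA]]] := c1 x clx.
apply: le_trans (gA _); rewrite mulr_ge0 ?(ltW g0)// sumr_ge0// => i _.
by rewrite -expr2 sqr_ge0.
Qed.

End coefficients.

(** * Remainders along a path *)

Section path_calculus.
Context (R : realType).
Local Notation R' := (measurableTypeR R).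
Implicit Types (f g : R -> R) (m : {measure set R' -> \bar R}).

(** Heine-Cantor along dyadic meshes: compactness of [s, t], in its near-covering form, turns the n
    found near each point into a single one. *)
Lemma dyadic_uniform_continuity f (s t e : R) : {within `[0, +oo[, continuous f} ->
  0 <= s <= t -> 0 < e ->
  \forall n \near \oo, forall x y, s <= x <= t -> s <= y <= t ->
    `|y - x| <= (t - s) / (2 ^ n)%:R -> `|f y - f x| <= e.
Proof.
move=> /subspace_continuousP cf /andP[s0 st] e0.
pose Q (n : nat) (x : R) := forall y, s <= y <= t ->
  `|y - x| <= (t - s) / (2 ^ n)%:R -> `|f y - f x| <= e.
suff : \forall n \near \oo, `[s, t] `<=` Q n.
  by apply: filterS => n h x y xst; apply: h; rewrite /= in_itv.
have mesh (a : R) : 0 < a -> \forall n \near \oo, (t - s) / (2 ^ n)%:R < a.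
  move=> a0.
  have h : (t - s) / (2 ^ n)%:R @[n --> \oo] --> (0 : R).
    rewrite -[X in _ --> X](mulr0 (t - s)); apply: cvgM; first exact: cvg_cst.
    have -> : (fun n => (2 ^ n)%:R^-1 : R) = (fun n => 2^-1 ^+ n).
      by apply/funext => n; rewrite natrX exprVn.
    by apply: cvg_expr; rewrite ger0_norm ?invr_ge0// invf_lt1// ltr1n.
  exact: (cvgr_lt _ h).
have ncov := (near_covering_withinP _).2 ((compact_near_coveringP _).1 (@segment_compact _ s t)).
apply: ncov => x /=; rewrite in_itv/= => /andP[sx xt].
have x0 : `[0, +oo[%classic x by rewrite /= in_itv/= (le_trans s0).
have e2 : 0 < e / 2 by rewrite divr_gt0.
have /cvgrPdist_lt/(_ _ e2) := cf x x0.
rewrite near_withinE => -[d /= d0 hd].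
have d2 : 0 < d / 2 by rewrite divr_gt0.
near=> x' n => /=; rewrite in_itv/= => /andP[sx' x't] y /andP[sy yt] yx.
have h z : s <= z -> `|x - z| < d -> `|f x - f z| < e / 2.
  by move=> sz zd; apply: hd => //=; rewrite in_itv/= (le_trans s0).
have xx' : `|x - x'| < d / 2.
  near: x'; exists (d / 2) => //= z.
have h1 : `|f x - f x'| < e / 2.
  by apply: h => //; rewrite (lt_le_trans xx')// ler_pdivrMr// ler_peMr ?ler1n// ltW.
have h2 : `|f x - f y| < e / 2.
  apply: h => //; rewrite (splitr d) -(subrKA x') (le_lt_trans (ler_normD _ _))//.
  rewrite ltrD// distrC (le_lt_trans yx)//; near: n; exact: mesh.
rewrite (splitr e) -(subrKA (f x)) (le_trans (ler_normD _ _))// lerD ?ltW//.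
by rewrite distrC.
Unshelve. all: by end_near. Qed.

(** The increment lives on a half-open interval because m may charge points. *)
Lemma Rintegral_increment m f a b : 0 <= a <= b ->
  m.-integrable `[0, b]%classic (EFin \o f) ->
  \int[m]_(x in `[0, b]%classic) f x - \int[m]_(x in `[0, a]%classic) f x =
  \int[m]_(x in `]a, b]%classic) f x.
Proof.
move=> /andP[a0 ab] fi.
have bE : `[0, b]%classic = `[0, a]%classic `|` `]a, b]%classic :> set R'.
  by rewrite -itv_bndbnd_setU// bnd_simp.
rewrite bE Rintegral_setU//; first by rewrite addrC addKr.
  by rewrite -bE.
apply/disj_setPS => x /= []; rewrite !in_itv/= => /andP[_ xa] /andP[ax _].
by have := lt_le_trans ax xa; rewrite ltxx.
Qed.

(** * The remainder along one path, as a deterministic estimate *)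

Section step.
Variables (m1 m2 : {measure set R' -> \bar R}) (U M N Q h1 h2 q : R -> R) (t : R).
Hypothesis t0 : 0 <= t.
Let I0 (r : R) : set R' := `[0, r]%classic.
Hypothesis ih1 : m1.-integrable (I0 t) (EFin \o h1).
Hypothesis ih2 : m2.-integrable (I0 t) (EFin \o h2).
Hypothesis iq : m1.-integrable (I0 t) (EFin \o q).
Hypothesis iU1 : m1.-integrable (I0 t) (EFin \o (fun r => 2 * (U r * h1 r) + 2 * q r)).
Hypothesis iU2 : m2.-integrable (I0 t) (EFin \o (fun r => 2 * (U r * h2 r))).
Hypothesis ME : forall r, 0 <= r <= t -> M r = U r - U 0
  - \int[m1]_(x in I0 r) h1 x + \int[m2]_(x in I0 r) h2 x.
Hypothesis NE : forall r, 0 <= r <= t -> N r = U r ^+ 2 - U 0 ^+ 2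
  - \int[m1]_(x in I0 r) (2 * (U x * h1 x) + 2 * q x)
  + \int[m2]_(x in I0 r) (2 * (U x * h2 x)).
Hypothesis QE : forall r, 0 <= r <= t -> Q r = 2 * \int[m1]_(x in I0 r) q x.

Let sub a b : 0 <= a -> b <= t -> (`]a, b]%classic : set R') `<=` I0 t.
Proof.
move=> a0 bt x; rewrite /I0/= !in_itv/= => /andP[ax xb].
by rewrite (le_trans a0 (ltW ax)) (le_trans xb).
Qed.

Let sub0 b : b <= t -> I0 b `<=` I0 t.
Proof.
by move=> bt x; rewrite /I0/= !in_itv/= => /andP[-> /le_trans]; apply.
Qed.

Let mI0 r : measurable (I0 r).
Proof. exact: measurable_itv. Qed.

(** [m1] will be dt and [m2] the Stieltjes measure of the local time, [h1] is Lhat u, [h2] the flux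
    and [q] the energy density; thus dV = h1 dm1 - h2 dm2. Each of dV (dM + dU) and 2 int (U - U_a)
    dV is at most 2 e times the mass of |h1| dm1 + |h2| dm2, whence 4 e. *)
Lemma remainder_step_bound a b e : 0 <= a -> a <= b -> b <= t ->
  (forall r, a <= r <= b -> `|U r - U a| <= e) -> `|M b - M a| <= e ->
  `|(M b ^+ 2 - Q b) - (M a ^+ 2 - Q a) - (N b - N a) - 2 * (M a - U a) * (M b - M a)|
  <= 4 * e * (\int[m1]_(x in `]a, b]%classic) `|h1 x| +
              \int[m2]_(x in `]a, b]%classic) `|h2 x|).
Proof.
move=> a0 ab bt Ue Me; set I : set R' := `]a, b]%classic.
have mI : measurable I by exact: measurable_itv.
have restr m f : m.-integrable (I0 t) (EFin \o f) ->
    m.-integrable (I0 b) (EFin \o f) /\ m.-integrable I (EFin \o f).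
  move=> fi; split; apply: integrableS fi => //; [exact: sub0|exact: sub].
have [jh1 kh1] := restr _ _ ih1; have [jh2 kh2] := restr _ _ ih2.
have [jq kq] := restr _ _ iq; have [jU1 kU1] := restr _ _ iU1.
have [jU2 kU2] := restr _ _ iU2.
have at0 : 0 <= a <= t by rewrite a0 (le_trans ab).
have bt0 : 0 <= b <= t by rewrite bt (le_trans a0).
have ab0 : 0 <= a <= b by rewrite a0.
have scale m c f : m.-integrable I (EFin \o f) -> m.-integrable I (EFin \o (fun x => c * f x)).
  by move=> fi; exact: (integrableZl mI c fi).
(* Integrability of (U - U_a) h1 is recovered by subtraction from that of the integrand of [N], of
   [q] and of [h1]. *)
have kD1 : m1.-integrable I (EFin \o (fun r => 2 * ((U r - U a) * h1 r))).
  have := integrableB mI (integrableB mI kU1 (scale _ 2 _ kq)) (scale _ (2 * U a) _ kh1).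
  by apply: eq_integrable => // x _ /=; congr EFin; ring.
have kD2 : m2.-integrable I (EFin \o (fun r => 2 * ((U r - U a) * h2 r))).
  have := integrableB mI kU2 (scale _ (2 * U a) _ kh2).
  by apply: eq_integrable => // x _ /=; congr EFin; ring.
have E1 : \int[m1]_(x in I) (2 * (U x * h1 x) + 2 * q x) =
    \int[m1]_(x in I) (2 * ((U x - U a) * h1 x)) +
    2 * \int[m1]_(x in I) q x + 2 * U a * \int[m1]_(x in I) h1 x.
  have kq2 := scale _ 2 _ kq; have kUh := scale _ (2 * U a) _ kh1.
  have kDq := integrableD mI kD1 kq2.
  rewrite -(RintegralZl _ mI kq) -(RintegralZl _ mI kh1) -(RintegralD mI kD1 kq2).
  rewrite -(@RintegralD _ _ _ _ _ _ _ mI kDq kUh).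
  by apply: eq_Rintegral => x _; ring.
have E2 : \int[m2]_(x in I) (2 * (U x * h2 x)) =
    \int[m2]_(x in I) (2 * ((U x - U a) * h2 x)) +
    2 * U a * \int[m2]_(x in I) h2 x.
  have kUh := scale _ (2 * U a) _ kh2.
  rewrite -(RintegralZl _ mI kh2) -(RintegralD mI kD2 kUh).
  by apply: eq_Rintegral => x _; ring.
have dM := Rintegral_increment ab0 jh1.
have dM2 := Rintegral_increment ab0 jh2.
have dN := Rintegral_increment ab0 jU1.
have dN2 := Rintegral_increment ab0 jU2.
have dQ := Rintegral_increment ab0 jq.
have e0 : 0 <= e by apply: le_trans Me; exact: normr_ge0.
have B m h : m.-integrable I (EFin \o h) ->
    m.-integrable I (EFin \o (fun r => 2 * ((U r - U a) * h r))) ->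
    `|\int[m]_(x in I) (2 * ((U x - U a) * h x))| <= 2 * e * \int[m]_(x in I) `|h x|.
  move=> hi hU; apply: (le_trans (le_normr_Rintegral mI hU)).
  rewrite -RintegralZl//; last exact: integrable_norm.
  apply: le_Rintegral => //; [exact: integrable_norm|by apply: scale; exact: integrable_norm|].
  move=> x; rewrite /I/= in_itv/= => /andP[ax xb].
  rewrite !normrM ger0_norm// mulrA ler_wpM2r// ler_wpM2l//.
  by apply: Ue; rewrite (ltW ax).
have B1 := B _ _ kh1 kD1; have B2 := B _ _ kh2 kD2.
have A1 := le_normr_Rintegral mI kh1; have A2 := le_normr_Rintegral mI kh2.
have Ub : `|U b - U a| <= e by apply: Ue; rewrite ab lexx.
rewrite E1 in dN; rewrite E2 in dN2.
move: dM dM2 dN dN2 dQ A1 A2 B1 B2.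
set dh1 := \int[m1]_(x in I) h1 x; set dh2 := \int[m2]_(x in I) h2 x.
set D1 := \int[m1]_(x in I) (2 * ((U x - U a) * h1 x)).
set D2 := \int[m2]_(x in I) (2 * ((U x - U a) * h2 x)).
set al := \int[m1]_(x in I) `|h1 x|; set be := \int[m2]_(x in I) `|h2 x|.
set dq := \int[m1]_(x in I) q x => dM dM2 dN dN2 dQ A1 A2 B1 B2.
have dME : M b - M a = (U b - U a) - (dh1 - dh2).
  rewrite (ME bt0) (ME at0) -dM -dM2; ring.
have dNE : N b - N a = U b ^+ 2 - U a ^+ 2 - (D1 + 2 * dq + 2 * U a * dh1) + (D2 + 2 * U a * dh2).
  rewrite (NE bt0) (NE at0) -dN -dN2; ring.
have dQE : Q b - Q a = 2 * dq.
  rewrite (QE bt0) (QE at0) -dQ; ring.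
(* Here dV = [dh1 - dh2] and 2 int (U - U_a) dV = [D1 - D2]. The terms in [dq] coming from [Q] and
   from [N] cancel, and the difference of squares produces the factor dM + dU. *)
have -> : (M b ^+ 2 - Q b) - (M a ^+ 2 - Q a) - (N b - N a) - 2 * (M a - U a) * (M b - M a)
    = - ((dh1 - dh2) * ((M b - M a) + (U b - U a))) + (D1 - D2).
  have -> : (M b ^+ 2 - Q b) - (M a ^+ 2 - Q a) - (N b - N a) - 2 * (M a - U a) * (M b - M a)
    = (M b - M a) ^+ 2 + 2 * U a * (M b - M a) - (Q b - Q a) - (N b - N a) by ring.
  rewrite dQE dNE dME; ring.
apply: (le_trans (ler_normD _ _)); rewrite normrN normrM.
have h1' : `|dh1 - dh2| * `|M b - M a + (U b - U a)| <= (al + be) * (2 * e).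
  apply: ler_pM => //.
    by rewrite (le_trans (ler_normB _ _))// lerD.
  by rewrite (le_trans (ler_normD _ _))// mulr_natl mulr2n lerD.
have h2' : `|D1 - D2| <= 2 * e * al + 2 * e * be.
  by rewrite (le_trans (ler_normB _ _))// lerD.
apply: (le_trans (lerD h1' h2')); rewrite le_eqVlt; apply/orP; left; apply/eqP; ring.
Qed.

Hypothesis cU : {within `[0, +oo[, continuous U}.
Hypothesis cM : {within `[0, +oo[, continuous M}.

(** Summing the one-step bounds leaves 4 e' times the mass of |h1| dm1 + |h2| dm2 on ]s, t], finite
    by absolute convergence; e' is arbitrary by uniform continuity of [U] and [M]. *)
Lemma sum_remainder_cvg0 s : 0 <= s <= t ->
  let p := dyadic s t in
  \sum_(k < 2 ^ n) `|(M (p n k.+1) ^+ 2 - Q (p n k.+1)) - (M (p n k) ^+ 2 - Q (p n k))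
    - (N (p n k.+1) - N (p n k))
    - 2 * (M (p n k) - U (p n k)) * (M (p n k.+1) - M (p n k))| @[n --> \oo] --> 0.
Proof.
move=> s0t p; have /andP[s0 st] := s0t.
pose F r := \int[m1]_(x in I0 r) `|h1 x| + \int[m2]_(x in I0 r) `|h2 x|.
apply/cvgr0Pnorm_le => e e0.
(* The 4 is that of [remainder_step_bound]; the added 1 keeps the denominator positive when F t = F
   s. *)
pose e' := e / (4 * (`|F t - F s| + 1)).
have e'0 : 0 < e' by rewrite /e' divr_gt0// mulr_gt0// ltr_wpDl.
have := dyadic_uniform_continuity cU s0t e'0.
have := dyadic_uniform_continuity cM s0t e'0.
apply: filterS2 => n Me Ue.
have pge k : s <= p n k by exact: dyadic_ge.
have ple k : (k <= 2 ^ n)%N -> p n k <= t.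
  by move=> kn; rewrite -[leRHS](dyadic_last s t n) dyadic_le.
have pS k : p n k <= p n k.+1 by exact: dyadic_le.
have mesh k : p n k.+1 - p n k = (t - s) / (2 ^ n)%:R.
  by rewrite /p /dyadic -natr1; ring.
rewrite ger0_norm ?sumr_ge0//.
apply: (@le_trans _ _ (\sum_(k < 2 ^ n) 4 * e' * (F (p n k.+1) - F (p n k)))).
  apply: ler_sum => k _.
  have kn := ltn_ord k.
  have a0 : 0 <= p n k by exact: le_trans s0 _.
  have bt := ple _ kn.
  have := @remainder_step_bound (p n k) (p n k.+1) e' a0 (pS k) bt.
  have nrm m h : m.-integrable (I0 t) (EFin \o h) ->
      m.-integrable (I0 (p n k.+1)) (EFin \o (fun x => `|h x|)).
    by move=> hi; apply: integrable_norm; apply: integrableS hi => //; exact: sub0.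
  have ab : 0 <= p n k <= p n k.+1 by rewrite a0 pS.
  rewrite -(Rintegral_increment ab (nrm _ _ ih1)) -(Rintegral_increment ab (nrm _ _ ih2)).
  move=> h; apply: (le_trans (h _ _)).
  - move=> r /andP[ar rb]; apply: Ue.
    + by rewrite pge ple// ltnW.
    + by rewrite (le_trans (pge k))// (le_trans rb).
    + by rewrite ger0_norm ?subr_ge0// -(mesh k) lerD2r.
  - apply: Me; rewrite ?pge ?ple//; first exact: ltnW.
    by rewrite ger0_norm ?subr_ge0// mesh.
  by rewrite ler_wpM2l// ?mulr_ge0 ?(ltW e'0)// /F; lra.
rewrite -big_distrr/= -(big_mkord xpredT (fun k => F (p n k.+1) - F (p n k))).
rewrite telescope_sumr// /p dyadic0 dyadic_last.
have h := ler_norm (F t - F s).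
have n0 : 0 <= `|F t - F s| by [].
have eE : 4 * e' * (`|F t - F s| + 1) = e.
  by rewrite /e'; field; rewrite gt_eqF// ltr_wpDl.
by rewrite -[leRHS]eE ler_wpM2l// ?mulr_ge0 ?(ltW e'0)//; lra.
Qed.

End step.
End path_calculus.

(** * Paths in the Alexandrov compactification *)

Section cemetery.
Context (R : realType) (d : nat).
Local Notation E := 'rV[R]_d.
Local Notation S := (one_point_compactification E).
Variables (F K : set E) (f : E -> R).
Hypothesis cK : compact K.
Hypothesis KF : K `<=` F.
Hypothesis cf : {within F, continuous f}.
Hypothesis f0 : forall x, F x -> ~ K x -> f x = 0.

Let clK : closed K.
Proof. by apply: compact_closed => //; exact: norm_hausdorff. Qed.

Lemma bounded_compact_support : exists2 C, 0 <= C & forall x, F x -> `|f x| <= C.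
Proof.
have : compact (f @` K).
  by apply: continuous_compact => //; exact: continuous_subspaceW cf.
move=> /compact_bounded[C [_ hC]].
exists (`|C| + 1); first by rewrite addr_ge0.
move=> x Fx; have [Kx|nKx] := pselect (K x).
  apply: (hC (`|C| + 1)); last by exists x.
  by rewrite (le_lt_trans (ler_norm _))// ltrDl.
by rewrite f0// normr0 addr_ge0.
Qed.

(** At the cemetery, the complement of the compact K together with [None] is a neighbourhood on
    which the extension vanishes as long as one stays in [F]. *)
Lemma ext0_continuous : {within with_cemetery F, continuous (ext0 f : S -> R)}.
Proof.
apply/subspace_continuousP => -[x|] /= Fx.
  have /subspace_continuousP/(_ x Fx) := cf => h B /h /=.
  rewrite /nbhs/= /within/= => hB.
  by apply: filterS hB => y /= hy Fy; exact: hy.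
move=> B /nbhs_singleton/= B0; rewrite /within/= nbhs_simpl.
exists K; first by split.
move=> [y|] /=; last by move=> _.
move=> [[z nKz [<-]] Fz|//].
suff : B (f z) by []; by rewrite f0.
Qed.

Lemma path_continuous (X : R -> S) :
  (forall t, 0 <= t -> with_cemetery F (X t)) ->
  {within `[0, +oo[, continuous X} ->
  {within `[0, +oo[, continuous (fun t => ext0 f (X t))}.
Proof.
move=> XF /subspace_continuousP cX; apply/subspace_continuousP => t t0.
have tt : 0 <= t by move: t0; rewrite /= in_itv/= andbT.
have /subspace_continuousP/(_ _ (XF t tt)) := ext0_continuous => h B /h.
rewrite /within/= => /(cX t t0); rewrite /within/= !nbhs_simpl/=.
apply: filterS => s hs s0; apply: hs => //; apply: XF.
by move: s0; rewrite /= in_itv/= andbT.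
Qed.

Let K' : set S := Some @` K.

Let clK' : closed K'.
Proof.
rewrite -[K']setCK; apply: open_closedC; rewrite openE => -[x|] /= nK.
  have nKx : ~ K x by move=> Kx; apply: nK; exists x.
  have : nbhs x (~` K) by apply: open_nbhs_nbhs; split=> //; exact: closed_openC.
  by apply: filterS => z nKz [z' Kz' [zz]]; apply: nKz; rewrite -zz.
exists K; first by split.
by move=> [z|] //= [[z' nKz [<-]] [z'' Kz'' [zz]]|[]//]; apply: nKz; rewrite -zz.
Qed.

Let measurable_closed (B : set S) : closed B -> measurable (B : set (borel S)).
Proof.
move=> /closed_openC oB; rewrite -[B]setCK; apply: (@measurableC _ (borel S)).
exact: sub_sigma_algebra.
Qed.

(** Off [F] nothing is known of f. The factor \1_K leaves f unchanged on [F] and reduces Borel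
    measurability to continuity on the closed set [K']. *)
Lemma measurable_ext0 :
  measurable_fun setT (ext0 (fun x => \1_K x * f x) : borel S -> R).
Proof.
set g := ext0 _.
have gK s : ~ K' s -> g s = 0.
  case: s => [x|] //= nK; rewrite indicE memNset ?mul0r// => Kx.
  by apply: nK; exists x.
have mK : measurable (K' : set (borel S)) by exact: measurable_closed.
have -> : (setT : set (borel S)) = K' `|` ~` K' by rewrite setUv.
apply/measurable_funU => //; first exact: measurableC.
split; last first.
  apply: (@eq_measurable_fun _ _ (borel S) R _ (fun=> 0)) => [s|]; last exact: measurable_cst.
  by move=> /set_mem nK; rewrite gK.
have cg : {within K', continuous g}.
  apply/subspace_continuousP => -[x|] [y Ky] // [yx]; rewrite -{}yx {x}.
  have /subspace_continuousP/(_ y (KF Ky)) := cf => h.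
  have gE z : K z -> g (Some z) = f z by move=> Kz; rewrite /g/= indicE mem_set// mul1r.
  move=> B Bg; have {Bg} : nbhs (f y) B by rewrite -gE.
  move=> /h; rewrite /within/= !nbhs_simpl/= => hB.
  apply: filterS hB => z hz [z' Kz' [zz]]; rewrite -zz in hz *.
  suff : B (g (Some z')) by [].
  by rewrite gE//; apply: hz; exact: KF.
apply: (measurability _ (RGenOpens.measurableE R)).
move=> _ [_ [a [b ->] <-]].
have oI : open (`]a, b[%classic : set R) by exact: interval_open.
have /continuousP/(_ _ oI) := cg.
rewrite -open_subspaceIT => /open_subspaceP[V oV VE].
have -> : K' `&` g @^-1` `]a, b[%classic = V `&` K'.
  by rewrite VE -setIA setIid setIC.
apply: (@measurableI _ (borel S)) => //; exact: sub_sigma_algebra.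
Qed.

End cemetery.

(** * Versions *)

Section versions.
Context d (T : measurableType d) (R : realType).

(* The library integral of a nonnegative function is a supremum over simple
   measurable functions below it, whether or not the function is measurable. *)
Lemma ge0_integral_version (m : {measure set T -> \bar R}) (f g : T -> \bar R) N :
  measurable N -> m N = 0%E -> measurable_fun setT g ->
  (forall x, (0 <= f x)%E) -> (forall x, (0 <= g x)%E) ->
  (forall x, ~ N x -> f x = g x) ->
  (\int[m]_x f x = \int[m]_x g x)%E.
Proof.
move=> mN mN0 mg f0 g0 fg.
have mono (h k : T -> \bar R) : (forall x, (0 <= h x)%E) -> (forall x, (0 <= k x)%E) ->
    (forall x, (h x <= k x)%E) -> (\int[m]_x h x <= \int[m]_x k x)%E.
  move=> h0 k0 hk; rewrite !ge0_integralTE//; apply: le_ereal_sup.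
  by move=> _ [s sh <-]; exists s => // x; exact: le_trans (sh x) (hk x).
have aeN (Q : T -> Prop) : (forall x, ~ N x -> Q x) -> {ae m, forall x, Q x}.
  by move=> h; exists N; split=> // x nQ; apply: contrapT => /h.
apply/eqP; rewrite eq_le; apply/andP; split.
  (* A simple function below f is below g off N, so its integral is at most that of g. For the
     converse, g cut off to the complement of N lies below f everywhere. *)
  rewrite [leLHS]ge0_integralTE//; apply: ge_ereal_sup => _ [s sf <-].
  rewrite -integralT_nnsfun; apply: ae_ge0_le_integral => //.
  - by move=> x _; rewrite lee_fin.
  - by apply/measurable_EFinP.
  - by apply: aeN => x Nx _; rewrite -fg.
have -> : (\int[m]_x g x = \int[m]_x (g \_ (~` N)) x)%E.
  apply: ge0_ae_eq_integral => //.
  - exact: (measurable_restrictT g (measurableC mN)).1 (measurable_funTS mg).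
  - by move=> x _; exact: erestrict_ge0.
  - by apply: aeN => x Nx _; rewrite patchE mem_set.
apply: mono => //; first by move=> x; exact: erestrict_ge0.
by move=> x; rewrite patchE; case: ifPn => // /set_mem /= Nx; rewrite fg.
Qed.

(** Neither A nor f has to be measurable: integrals over W0 and over events of the completed
    filtration become ordinary ones in this way. *)
Lemma integral_version (m : {measure set T -> \bar R}) (f g : T -> \bar R) A B N :
  measurable N -> m N = 0%E -> measurable_fun setT g -> measurable B ->
  (forall x, ~ N x -> A x <-> B x) -> (forall x, ~ N x -> A x -> f x = g x) ->
  (\int[m]_(x in A) f x = \int[m]_(x in B) g x)%E.
Proof.
move=> mN mN0 mg mB AB fg.
rewrite integral_mkcond [RHS]integral_mkcond integralE [RHS]integralE.
have mgB : measurable_fun setT (g \_ B).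
  exact: (measurable_restrictT g mB).1 (measurable_funTS mg).
have e x : ~ N x -> (f \_ A) x = (g \_ B) x.
  move=> Nx; rewrite !patchE; case: ifPn => [/set_mem Ax|].
    by rewrite mem_set ?fg//; exact/AB.
  by move=> /negP nA; rewrite memNset// => /(AB x Nx) Ax; apply: nA; rewrite inE.
by congr (_ - _)%E; apply: (ge0_integral_version mN mN0) => //;
  [exact: measurable_funepos|move=> x /e h; rewrite !funeposE h
  |exact: measurable_funeneg|move=> x /e h; rewrite !funenegE h].
Qed.

(** A real number is the infimum of the rationals above it. Each event {f < q} is replaced by its
    version, with value +oo off it so that the infimum ignores q, and the countably many exceptional
    sets are collected. [null] is abstract so that any initial law can be inserted. *)
Lemma measurable_version (G : set (set T)) (null : set T -> Prop) (W0 : set T) (f : T -> R) :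
  (forall N : nat -> set T, (forall n, null (N n)) -> null (\bigcup_n N n)) ->
  (forall C : set (measurableTypeR R), measurable C -> exists B N,
     [/\ <<s G >> B, null N & forall x, W0 x -> ~ N x -> f x \in C <-> B x]) ->
  exists (g : T -> R) N, [/\ measurable_fun setT (g : g_sigma_algebraType G -> R),
    null N & forall x, W0 x -> ~ N x -> f x = g x].
Proof.
(* An enumeration of the rationals; integers that code no rational give 0, a harmless repetition. *)
move=> nullU fG; pose q n : R := ratr (odflt 0 (unpickle n : option rat)).
have /choice[BN BNP] n : exists BN : set T * set T, [/\ <<s G >> BN.1, null BN.2 &
    forall x, W0 x -> ~ BN.2 x -> f x \in `]-oo, (q n)[%classic <-> BN.1 x].
  have [|B [N [? ? ?]]] := fG `]-oo, (q n)[%classic; first exact: measurable_itv.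
  by exists (B, N).
pose h n (x : g_sigma_algebraType G) : \bar R := if x \in (BN n).1 then (q n)%:E else +oo%E.
have mh n : measurable_fun setT (h n).
  apply: measurable_fun_ifT; [|exact: measurable_cst..].
  apply: (measurable_fun_bool true); rewrite setTI.
  have [GB _ _] := BNP n.
  rewrite [X in measurable X](_ : _ = (BN n).1)//.
  by apply/seteqP; split=> x /= => [/set_mem|/mem_set].
pose g x := fine (einfs (h ^~ x) 0).
exists g, (\bigcup_n (BN n).2); split.
- by apply: measurableT_comp => //; exact: measurable_fun_einfs.
- by apply: nullU => n; have [] := BNP n.
move=> x Wx nN; rewrite /g.
suff -> : einfs (h ^~ x) 0 = (f x)%:E by [].
have hE n : h n x = if f x < q n then (q n)%:E else +oo%E.
  have [_ _ /(_ x Wx)h1] := BNP n; rewrite /h.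
  have {}h1 : f x \in `]-oo, (q n)[%classic <-> (BN n).1 x.
    by apply: h1 => Nx; apply: nN; exists n.
  rewrite inE/= in_itv/= in h1.
  case: ifPn => [/set_mem/h1 ->//|]; case: ifPn => // /h1 Bx.
  by rewrite mem_set.
apply/eqP; rewrite eq_le; apply/andP; split; last first.
  apply: le_ereal_inf_tmp => _ [n _ <-]; rewrite hE; case: ifPn => [fq|_]; last exact: leey.
  by rewrite lee_fin ltW.
apply/lee_addgt0Pr => e e0.
have [|r] := @rat_in_itvoo R (f x) (f x + e); first by rewrite ltrDl.
rewrite in_itv/= => /andP[fr re].
apply: (@le_trans _ _ (ratr r)%:E); last by rewrite -EFinD lee_fin ltW.
apply: ereal_inf_lbound; exists (pickle r) => //.
by rewrite hE /q pickleK /= fr.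
Qed.

End versions.

(** * Time integrals *)

Section time_integral.
Context (R : realType).
Implicit Types f : R -> R.
Local Notation mu := (@lebesgue_measure R).

Lemma continuous_integrable f t : {within `[0, +oo[, continuous f} ->
  mu.-integrable `[0, t]%classic (EFin \o f).
Proof.
move=> cf; apply: continuous_compact_integrable; first exact: segment_compact.
by apply: continuous_subspaceW cf => x /=; rewrite !in_itv/= andbT => /andP[].
Qed.

Lemma fine_lebesgue_oc (a b : R) : a <= b -> fine (mu `]a, b]%classic) = b - a.
Proof.
move=> ab; rewrite lebesgue_measure_itv/= lte_fin.
case: ltP => [//|ba]; have -> : a = b by apply/eqP; rewrite eq_le ab.
by rewrite subrr.
Qed.

Lemma continuous_integrable_oc f a b : 0 <= a -> {within `[0, +oo[, continuous f} ->
  mu.-integrable `]a, b]%classic (EFin \o f).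
Proof.
move=> a0 cf; apply: integrableS (continuous_integrable b cf) => //.
move=> x; rewrite /= !in_itv/= => /andP[xa ->]; rewrite andbT.
by rewrite (le_trans a0)// ltW.
Qed.

Let within_cst (c : R) : {within `[0, +oo[, continuous (fun _ : R => c)}.
Proof.
by move=> x; exact: cvg_cst.
Qed.

Lemma riemann_sum_cvg f t : 0 <= t -> {within `[0, +oo[, continuous f} ->
  \sum_(k < 2 ^ n) f (dyadic 0 t n k) * (t / (2 ^ n)%:R) @[n --> \oo] -->
  \int[mu]_(x in `[0, t]%classic) f x.
Proof.
move=> t0 cf; pose F r := \int[mu]_(x in `[0, r]%classic) f x.
have ifi r : mu.-integrable `[0, r]%classic (EFin \o f) by exact: continuous_integrable.
apply/cvgrPdist_le => e e0.
have e'0 : 0 < e / (t + 1) by rewrite divr_gt0// ltr_wpDl.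
have t00 : 0 <= (0 : R) <= t by rewrite lexx.
have := dyadic_uniform_continuity cf t00 e'0.
apply: filterS => n cfn.
pose p k := dyadic 0 t n k.
have pge k : 0 <= p k by exact: dyadic_ge.
have ple k : (k <= 2 ^ n)%N -> p k <= t.
  by move=> kn; rewrite -[leRHS](dyadic_last 0 t n) dyadic_le.
have pS k : p k <= p k.+1 by exact: dyadic_le.
have mesh k : p k.+1 - p k = t / (2 ^ n)%:R.
  by rewrite /p /dyadic -natr1 subr0; ring.
have FE : F t = \sum_(k < 2 ^ n) (F (p k.+1) - F (p k)).
  rewrite -(big_mkord xpredT (fun k => F (p k.+1) - F (p k))) telescope_sumr//.
  rewrite /p dyadic0 dyadic_last [X in _ - X](_ : _ = 0) ?subr0//.
  by rewrite /F set_itv1 Rintegral_set1.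
rewrite -/(F t) FE -sumrB (le_trans (ler_norm_sum _ _ _))//.
apply: (@le_trans _ _ (\sum_(k < 2 ^ n) e / (t + 1) * (p k.+1 - p k))).
  apply: ler_sum => k _; have kn := ltn_ord k.
  have ab : 0 <= p k <= p k.+1 by rewrite pge pS.
  have fE := Rintegral_increment ab (ifi (p k.+1)).
  rewrite /F fE.
  pose I : set (measurableTypeR R) := `]p k, p k.+1]%classic; rewrite -/I.
  have mI : measurable I by exact: measurable_itv.
  have ifI : mu.-integrable I (EFin \o f) by exact: continuous_integrable_oc.
  have cI (c : R) : mu.-integrable I (EFin \o (fun=> c)).
    have := @continuous_integrable_oc (fun=> c) (p k) (p k.+1) (pge k) (@within_cst c).
    exact.
  have -> : f (p k) * (t / (2 ^ n)%:R) = \int[mu]_(x in I) f (p k).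
    by rewrite Rintegral_cst// /I fine_lebesgue_oc// mesh.
  have iB : mu.-integrable I (EFin \o (fun x => f x - f (p k))).
    exact: (@integrableB _ _ _ mu I mI (EFin \o f) (EFin \o cst (f (p k))) ifI (cI (f (p k)))).
  rewrite -RintegralB// (le_trans (le_normr_Rintegral mI iB))//.
  rewrite -[X in _ * X](fine_lebesgue_oc (pS k)) -Rintegral_cst//.
  apply: le_Rintegral => //.
    exact: integrable_norm iB.
  move=> x; rewrite /I/= in_itv/= => /andP[ax xb]; apply: cfn.
  - by rewrite pge ple// ltnW.
  - by rewrite (le_trans (pge k) (ltW ax)) (le_trans xb)// ple.
  - by rewrite ger0_norm ?subr_ge0 ?(ltW ax)// subr0 -(mesh k) lerD2r.
rewrite -big_distrr/= -(big_mkord xpredT (fun k => p k.+1 - p k)) telescope_sumr//.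
rewrite /p dyadic0 dyadic_last subr0 mulrAC ler_pdivrMr ?ltr_wpDl//.
by rewrite ler_pM2l// lerDl.
Qed.

Lemma time_integral_bound f C s t : 0 <= s <= t -> {within `[0, +oo[, continuous f} ->
  (forall r, 0 <= r -> `|f r| <= C) ->
  `|\int[mu]_(x in `[0, t]%classic) f x - \int[mu]_(x in `[0, s]%classic) f x|
  <= C * (t - s).
Proof.
move=> st cf fC; have /andP[s0 s_t] := st.
rewrite (Rintegral_increment st (continuous_integrable t cf)).
set I := `]s, t]%classic.
have mI : measurable I by exact: measurable_itv.
have ifI : mu.-integrable I (EFin \o f) by exact: continuous_integrable_oc.
rewrite (le_trans (le_normr_Rintegral _ _))// -(fine_lebesgue_oc s_t) -Rintegral_cst//.
apply: le_Rintegral => //; first exact: integrable_norm.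
  exact: (@continuous_integrable_oc (fun=> C) s t s0 (@within_cst C)).
move=> x; rewrite /I/= in_itv/= => /andP[sx _]; apply: fC.
by rewrite (le_trans s0)// ltW.
Qed.

Lemma time_integral_continuous f C : {within `[0, +oo[, continuous f} ->
  (forall r, 0 <= r -> `|f r| <= C) ->
  {within `[0, +oo[, continuous (fun t => \int[mu]_(x in `[0, t]%classic) f x)}.
Proof.
move=> cf fC; apply/subspace_continuousP => t t0.
have tt : 0 <= t by move: t0; rewrite /= in_itv/= andbT.
have C0 : 0 <= C by apply: le_trans (fC 0 _).
apply/cvgrPdist_le => e e0; rewrite near_withinE.
exists (e / (C + 1)) => /=; first by rewrite divr_gt0// ltr_wpDl.
move=> s /= ts; rewrite in_itv/= andbT => s0.
have h a b : 0 <= a -> a <= b -> `|b - a| < e / (C + 1) ->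
    `|\int[mu]_(x in `[0, b]%classic) f x - \int[mu]_(x in `[0, a]%classic) f x| <= e.
  move=> a0 ab hab.
  have ab' : 0 <= a <= b by rewrite a0.
  rewrite (le_trans (time_integral_bound ab' cf fC))//.
  rewrite ger0_norm ?subr_ge0// ltr_pdivlMr ?ltr_wpDl// in hab.
  by rewrite mulrC (le_trans _ (ltW hab))// ler_wpM2l ?subr_ge0// lerDl.
have [st|ts'] := leP s t; first exact: h.
by rewrite distrC; apply: h => //; [exact: ltW|rewrite distrC].
Qed.

End time_integral.

(** * Completed filtrations *)

Section path_law.
Context (R : realType) d (T : measurableType d) d' (T' : measurableType d').

(** A name for P a to which the probability structure is attached, the martingale lemmas being
    stated for a probability. *)
Definition path_law (P : R.-pker T ~> T') (a : T) : set T' -> \bar R := P a.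

HB.instance Definition _ (P : R.-pker T ~> T') (a : T) :=
  Measure.copy (path_law P a) (P a).

HB.instance Definition _ (P : R.-pker T ~> T') (a : T) :=
  Measure_isProbability.Build _ _ _ (path_law P a) (prob_kernel a).

End path_law.

Section restricted_process.
Context (R : realType) (d : nat).
Local Notation E := 'rV[R]_d.
Local Notation S := (one_point_compactification E).
Context (dW : measure_display) (W : measurableType dW).
Variables (X : R -> W -> S) (P : R.-pker (borel S) ~> W) (F : set E).
Hypothesis mX : forall (s : R) (C : set (borel S)), 0 <= s -> measurable C ->
  measurable (X s @^-1` C).

Definition past (t : R) : set (set W) :=
  [set B | exists (s : R) (C : set (borel S)),
     [/\ 0 <= s <= t, measurable C & B = X s @^-1` C]].

Local Notation W0 := (restricted_paths X F).
Local Notation Ft := (restricted_filtration X P F).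
Local Notation S0 := (with_cemetery F).

Lemma past_measurable t : <<s past t >> `<=` measurable.
Proof.
apply: smallest_sub; first exact: sigma_algebra_measurable.
by move=> _ [s [C [/andP[s0 _] mC ->]]]; exact: mX.
Qed.

Lemma past_le s t : s <= t -> <<s past s >> `<=` <<s past t >>.
Proof.
move=> st; apply: sub_sigma_algebra2 => _ [r [C [/andP[r0 rs] mC ->]]].
by exists r, C; rewrite r0 (le_trans rs).
Qed.

Lemma measurable_fun_past (f : S -> R) s t : 0 <= s <= t ->
  measurable_fun setT (f : borel S -> R) ->
  measurable_fun setT ((fun w => f (X s w)) : g_sigma_algebraType (past t) -> R).
Proof.
move=> st mf _ C mC; rewrite setTI; apply: sub_sigma_algebra.
exists s, (f @^-1` C); split=> //.
by rewrite -[_ @^-1` _]setTI; exact: mf.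
Qed.

(** Negligible for P_nu, the mixture of the P_x under nu. All initial laws matter because the
    completion quantifies over them; the Dirac law at x gives back P_x. *)
Definition null_from (nu : probability (borel S) R) (N : set W) : Prop :=
  measurable N /\ (\int[nu]_x P x N = 0)%E.

Lemma null_from_bigcup nu (N : nat -> set W) :
  (forall n, null_from nu (N n)) -> null_from nu (\bigcup_n N n).
Proof.
move=> nN; have mN n : measurable (N n) by have [] := nN n.
have mU : measurable (\bigcup_n N n) by exact: bigcupT_measurable.
split=> //; apply/eqP; rewrite eq_le integral_ge0 ?andbT//.
apply: (@le_trans _ _ (\int[nu]_x (\sum_(0 <= n <oo) P x (N n)))%E).
  apply: ge0_le_integral => //.
  - exact: measurable_kernel.
  - by apply: ge0_emeasurable_sum => // n _; exact: measurable_kernel.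
  - by move=> x _; exact: measure_sigma_subadditive.
rewrite integral_nneseries//; last by move=> n; exact: measurable_kernel.
by rewrite eseries0// => n _ _; have [] := nN n.
Qed.

Lemma null_fromU nu N1 N2 : null_from nu N1 -> null_from nu N2 -> null_from nu (N1 `|` N2).
Proof.
move=> n1 n2; rewrite -bigcup2E; apply: null_from_bigcup => -[|[|n]] //=.
by split=> //; rewrite (eq_integral (fun=> 0%E)) ?integral0// => x _; rewrite measure0.
Qed.

Lemma null_from_dirac x N :
  null_from \d_(Some x : borel S) N <-> measurable N /\ P (Some x) N = 0%E.
Proof.
have e : measurable N -> (\int[\d_(Some x : borel S)]_y P y N = P (Some x) N)%E.
  move=> mN; rewrite integral_dirac//; last exact: measurable_kernel.
  by rewrite diracT mul1e.
by split=> -[mN]; [rewrite e|split=> //; rewrite e].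
Qed.

Lemma dirac_state x : F x -> \d_(Some x : borel S) S0 = 1%E :> \bar R.
Proof. by move=> Fx; rewrite diracE mem_set. Qed.

Lemma past_trace t B : <<s past t >> B -> Ft t (W0 `&` B).
Proof.
move=> GB; split; first by move=> w [].
move=> nu _; exists B, set0; split=> //.
  rewrite (eq_integral (fun=> 0%E)) ?integral0// => x _; exact: measure0.
by move=> w [[[Ww Bw] []]//|[[Bw Ww] []]].
Qed.

Lemma filtration_past t B (nu : probability (borel S) R) : nu S0 = 1%E -> Ft t B -> B `<=` W0 /\
  exists C N, [/\ <<s past t >> C, null_from nu N &
    forall w, W0 w -> ~ N w -> B w <-> C w].
Proof.
move=> nu1 [BW h]; split=> //; have [C [N [GC mN N0 sub]]] := h nu nu1.
exists C, N; split=> // w Ww Nw; split=> [Bw|Cw]; apply: contrapT => n; apply: Nw; apply: sub.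
  by left; split=> // -[].
by right.
Qed.

(** The completion supplies a raw version of each event {M_t in C}; [measurable_version] glues them
    into one function. *)
Lemma adapted_version (nu : probability (borel S) R) M t :
  nu S0 = 1%E -> adapted Ft W0 M -> 0 <= t ->
  exists (g : W -> R) N,
    [/\ measurable_fun setT (g : g_sigma_algebraType (past t) -> R),
        null_from nu N & forall w, W0 w -> ~ N w -> M t w = g w].
Proof.
move=> nu1 aM t0; apply: (measurable_version (null_from_bigcup (nu := nu))) => C mC.
have [_ [B [N [GB nN BN]]]] := filtration_past nu1 (aM t C t0 mC).
exists B, N; split=> // w Ww Nw; rewrite -(BN w Ww Nw) inE.
by split=> // -[].
Qed.

(** The completed filtration asks for an approximation under each nu separately, so g and N may
    depend on nu. *)
Lemma version_adapted M t : 0 <= t ->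
  (forall nu : probability (borel S) R, nu S0 = 1%E -> exists (g : W -> R) N,
    [/\ measurable_fun setT (g : g_sigma_algebraType (past t) -> R),
        null_from nu N & forall w, W0 w -> ~ N w -> M t w = g w]) ->
  forall C : set (measurableTypeR R), measurable C -> Ft t (W0 `&` M t @^-1` C).
Proof.
move=> t0 h C mC; split; first by move=> w [].
move=> nu nu1; have [g [N [mg [mN N0] gE]]] := h nu nu1.
exists (g @^-1` C), N; split=> //.
  by rewrite -[X in raw_filtration _ _ X]setTI; exact: mg.
move=> w [[[Ww Mw] n]|[[gw Ww] n]]; apply: contrapT => Nw; apply: n; split=> //.
  by rewrite /= -gE.
by rewrite /= gE.
Qed.

Section fixed_start.
Variable x : E.
Hypothesis Fx : F x.
Hypothesis aeW0 : {ae P (Some x), forall w, W0 w}.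
Local Notation Px := (path_law P (Some x)).

Lemma full_measure_null : exists2 N, measurable N /\ P (Some x) N = 0%E &
  forall w, ~ N w -> W0 w.
Proof.
have [N [mN N0 sub]] := aeW0; exists N => // w Nw.
by apply: contrapT => nW; apply: Nw; exact: sub.
Qed.

(* Ft is completed, so M t is only almost everywhere equal to a function that
   is measurable for the past. *)
Lemma adapted_versions M : adapted Ft W0 M -> exists M' : R -> W -> R,
  forall t, 0 <= t -> measurable_fun setT (M' t : g_sigma_algebraType (past t) -> R) /\
    exists N, [/\ measurable N, P (Some x) N = 0%E &
      forall w, ~ N w -> W0 w /\ M t w = M' t w].
Proof.
move=> aM.
have /choice[M' h] (t : R) : exists g : W -> R, 0 <= t ->
    measurable_fun setT (g : g_sigma_algebraType (past t) -> R) /\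
    exists N, [/\ measurable N, P (Some x) N = 0%E &
      forall w, ~ N w -> W0 w /\ M t w = g w].
  have [t0|t0] := leP 0 t; last by exists (fun=> 0).
  have [g [N [mg nN gE]]] := adapted_version (dirac_state Fx) aM t0.
  exists g => _; split=> //.
  have [N1 [mN1 N10] W1] := full_measure_null.
  have [mU U0] : measurable (N `|` N1) /\ P (Some x) (N `|` N1) = 0%E.
    by apply/null_from_dirac/null_fromU => //; exact/null_from_dirac.
  exists (N `|` N1); split=> // w /not_orP[Nw N1w]; have Ww := W1 _ N1w; split=> //.
  exact: gE.
by exists M'.
Qed.

(** Events of the raw past, cut down to W0, belong to the completed filtration, so the martingale
    property passes to raw versions. The exceptional set depends on t, hence continuity of paths
    does not pass to [M']. *)
Lemma L2_version M : continuous_L2_martingale Ft W0 (P (Some x)) M ->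
  exists M' : R -> W -> R, L2_martingale_R Px past M' /\
    forall t, 0 <= t -> exists N, [/\ measurable N, P (Some x) N = 0%E &
      forall w, ~ N w -> W0 w /\ M t w = M' t w].
Proof.
move=> [[aM _ mM] _ M2]; have [M' M'P] := adapted_versions aM.
exists M'; split; last by move=> t t0; have [] := M'P t t0.
have mM' t : 0 <= t -> measurable_fun setT (M' t).
  move=> t0; apply: sub_sigma_measurable_fun (M'P t t0).1; exact: past_measurable.
have sq t : 0 <= t -> sq_integrable Px (M' t).
  move=> t0; split; first exact: mM'.
  have [N [mN N0 NE]] := (M'P t t0).2.
  apply/integrableP; split; first by apply/measurable_EFinP/measurable_funX/mM'.
  under eq_integral do rewrite /= ger0_norm ?sqr_ge0//.
  rewrite -(@integral_version _ _ _ Px (fun w => (M t w ^+ 2)%:E) _ W0 setT N)//.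
  - exact: M2.
  - by apply/measurable_EFinP/measurable_funX/mM'.
  - by move=> w /NE[].
  - by move=> w /NE[_ ->].
split=> //; first by move=> t t0; exact: (M'P t t0).1.
move=> s t B st GB; have /andP[s0 s_t] := st; have t0 := le_trans s0 s_t.
have mB := past_measurable GB.
have rs := sq_integrable_int (sq s s0); have rt := sq_integrable_int (sq t t0).
have BE r : 0 <= r -> (\int[P (Some x)]_(w in W0 `&` B) (M r w)%:E =
    \int[P (Some x)]_(w in B) (M' r w)%:E)%E.
  move=> r0; have [N [mN N0 NE]] := (M'P r r0).2.
  apply: (@integral_version _ _ _ _ _ _ _ _ N) => //.
  - by apply/measurable_EFinP/mM'.
  - by move=> w /NE[Ww _]; split=> // -[].
  - by move=> w /NE[_ ->].
have h := mM _ _ _ st (past_trace GB); rewrite !BE// in h.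
have -> : \int[Px]_w (\1_B w * (M' t w - M' s w)) =
    \int[Px]_(w in B) (M' t w - M' s w).
  rewrite [RHS]Rintegral_mkcond; apply: eq_Rintegral => w _.
  by rewrite patchE indicE; case: ifP => _; rewrite ?mul1r ?mul0r.
have int r : 0 <= r -> Px.-integrable B (EFin \o M' r).
  by move=> r0; apply: integrableS (sq_integrable_int (sq r r0)).
rewrite RintegralB//; [|exact: int..].
by rewrite /Rintegral [X in fine X - _]h subrr.
Qed.

End fixed_start.

Section time_integrals.
Variables (K : set E) (f : E -> R).
Hypothesis cK : compact K.
Hypothesis KF : K `<=` F.
Hypothesis cf : {within F, continuous f}.
Hypothesis f0 : forall y, F y -> ~ K y -> f y = 0.

(* Riemann sums give measurability for the past; W0 need not be measurable, so
   Fubini's theorem does not apply directly. *)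
Lemma time_integral_version : exists2 C, 0 <= C & exists Q : R -> W -> R,
  [/\ forall t, 0 <= t -> measurable_fun setT (Q t : g_sigma_algebraType (past t) -> R),
      forall t w, 0 <= t -> `|Q t w| <= C * t &
      forall t w, 0 <= t -> W0 w -> {within `[0, +oo[, continuous (fun s => X s w)} ->
        \int[@lebesgue_measure R]_(s in `[0, t]%classic) ext0 f (X s w) = Q t w].
Proof.
have [C C0 fC] := bounded_compact_support cK KF cf f0; exists C => //.
pose g : S -> R := ext0 (fun y => \1_K y * f y).
have mg : measurable_fun setT (g : borel S -> R) by exact: (@measurable_ext0 _ _ F).
pose Rm n t w := \sum_(k < 2 ^ n) g (X (dyadic 0 t n k) w) * (t / (2 ^ n)%:R).
(* The upper limit is measurable whether or not the Riemann sums converge. Clamping it to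
   [- C t, C t] gives the bound for every w, also off W0, and changes nothing where the sums
   converge to the integral. *)
pose L t w := fine (limn_esup (fun n => (Rm n t w)%:E)).
pose Q t w := Num.max (- (C * t)) (Num.min (C * t) (L t w)).
exists Q; split.
- move=> t t0; apply: measurable_maxr; first exact: measurable_cst.
  apply: measurable_minr; first exact: measurable_cst.
  apply: measurableT_comp => //; apply: measurable_fun_limn_esup => n.
  apply/measurable_EFinP; apply: measurable_sum => k.
  apply: measurable_funM; last exact: measurable_cst.
  apply: measurable_fun_past mg; rewrite dyadic_ge//=.
  rewrite -[leRHS](dyadic_last 0 t n) dyadic_le//.
  exact: ltnW.
- move=> t w t0; have Ct : 0 <= C * t by rewrite mulr_ge0.
  rewrite ler_norml /Q le_max lexx/= ge_max ge_min lexx/= andbT.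
  by rewrite (le_trans _ Ct)// oppr_le0.
move=> t w t0 Ww cX.
pose phi s := ext0 f (X s w).
have cphi : {within `[0, +oo[, continuous phi} by exact: (path_continuous cK cf f0 Ww cX).
have phiE s : 0 <= s -> g (X s w) = phi s.
  move=> s0; have := Ww s s0; rewrite /g /phi; case: (X s w) => [y|] //= Fy.
  by have [Ky|nK] := pselect (K y); [rewrite indicE mem_set// mul1r|rewrite f0// mulr0].
have phiC s : 0 <= s -> `|phi s| <= C.
  move=> s0; have := Ww s s0; rewrite /phi; case: (X s w) => [y|] /= Fy; first exact: fC.
  by rewrite normr0.
have cv : Rm n t w @[n --> \oo] -->
    \int[@lebesgue_measure R]_(s in `[0, t]%classic) phi s.
  have -> : (fun n => Rm n t w) =
      (fun n => \sum_(k < 2 ^ n) phi (dyadic 0 t n k) * (t / (2 ^ n)%:R)).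
    apply/funext => n; apply: eq_bigr => k _; rewrite phiE//; exact: dyadic_ge.
  exact: riemann_sum_cvg.
pose I := \int[@lebesgue_measure R]_(s in `[0, t]%classic) phi s.
rewrite -[LHS]/I; rewrite -/I in cv.
have LE : L t w = I.
  rewrite /L; have ecv : (fun n => (Rm n t w)%:E) @ \oo --> I%:E.
    by apply: cvg_comp cv _; exact: cvg_id.
  rewrite is_cvg_limn_esupE; last by apply/cvg_ex; eexists; exact: ecv.
  by rewrite (cvg_lim _ ecv).
have IC : `|I| <= C * t.
  have t00 : 0 <= (0 : R) <= t by rewrite lexx.
  have := time_integral_bound t00 cphi phiC.
  by rewrite set_itv1 Rintegral_set1 !subr0.
rewrite /Q LE; move: IC; rewrite ler_norml => /andP[h1 h2].
by rewrite (min_idPr h2) (max_idPr h1).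
Qed.

End time_integrals.

End restricted_process.

Lemma ae_conj d (T : measurableType d) (R : realType)
    (m : {measure set T -> \bar R}) (Q1 Q2 : T -> Prop) :
  {ae m, forall x, Q1 x} -> {ae m, forall x, Q2 x} ->
  {ae m, forall x, Q1 x /\ Q2 x}.
Proof. exact: filterI. Qed.

Lemma ae_impl d (T : measurableType d) (R : realType)
    (m : {measure set T -> \bar R}) (Q1 Q2 : T -> Prop) :
  (forall x, Q1 x -> Q2 x) -> {ae m, forall x, Q1 x} -> {ae m, forall x, Q2 x}.
Proof. exact: filterS. Qed.

(** * The quadratic variation *)

Theorem theorem3p12 (R : realType) (d : nat) (hd : (2 <= d)%N)
  (* Lebesgue measure dx, the domain and the coefficients *)
  (lam : {measure set (borel 'rV[R]_d) -> \bar R}) (hlam : is_lebesgue lam)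
  (Omega : set 'rV[R]_d) (hO : open Omega)
  (A : 'rV[R]_d -> 'M[R]_d) (rho : 'rV[R]_d -> R)
  (hrho : forall x, closure Omega x -> 0 <= rho x)
  (* mu = rho dx on closure Omega *)
  (mu : {measure set (borel 'rV[R]_d) -> \bar R})
  (hmu : forall B : set (borel 'rV[R]_d), measurable B ->
     mu B = (\int[lam]_(x in B `&` closure Omega) (rho x)%:E)%E)
  (* the weak gradient of rho, the exponent and the boundary part *)
  (drho : 'rV[R]_d -> 'rV[R]_d) (p : R) (Gamma2 : set 'rV[R]_d)
  (hC1 : cond1 Omega A) (hC2 : cond2 lam Omega A rho)
  (hC3 : cond3 lam mu Omega rho drho p) (hC4 : cond4 lam mu Omega A Gamma2)
  (n : 'rV[R]_d -> 'rV[R]_d)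
  (hn : forall x, Gamma2 x -> outward_unit_normal Omega x (n x))
  (* the diffusion process *)
  (dW : measure_display) (W : measurableType dW)
  (X : R -> W -> one_point_compactification 'rV[R]_d)
  (theta : R -> W -> W)
  (P : R.-pker (borel (one_point_compactification 'rV[R]_d)) ~> W)
  (hM : diffusion X theta P (closure Omega))
  (hform : associated_with_form X P lam mu Omega A)
  (hinv : invariant_set X P (E1 Omega rho Gamma2))
  (hfeller : Lp_strong_feller X P mu p (E1 Omega rho Gamma2))
  (* nu = 1_{Gamma2 cap {rho > 0}} sigma, and the boundary local time *)
  (nu : {measure set (borel 'rV[R]_d) -> \bar R})
  (hnu : forall B : set (borel 'rV[R]_d), measurable B ->
     nu B = hausdorff d.-1 (B `&` (Gamma2 `&` positive_rho rho)))
  (ell : R -> W -> \bar R)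
  (hell : strict_PCAF X theta P (E1 Omega rho Gamma2) ell)
  (hrevuz : revuz X P mu nu (E1 Omega rho Gamma2) ell)
  (* the processes M^[v], v in C^2_c(E_1), are well defined and are continuous
     square-integrable martingales *)
  (hdef : forall v, C2c Omega rho Gamma2 v ->
     forall x, E1 Omega rho Gamma2 x ->
       {ae P (Some x), forall w, restricted_paths X (E1 Omega rho Gamma2) w ->
          Mproc_defined X Omega A rho drho Gamma2 n ell v w})
  (hmart : forall v, C2c Omega rho Gamma2 v ->
     forall x, E1 Omega rho Gamma2 x ->
       continuous_L2_martingale
         (restricted_filtration X P (E1 Omega rho Gamma2))
         (restricted_paths X (E1 Omega rho Gamma2)) (P (Some x))
         (Mproc X Omega A rho drho Gamma2 n ell v))
  (u : 'rV[R]_d -> R) (hu : C2c Omega rho Gamma2 u) :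
  forall x, E1 Omega rho Gamma2 x ->
    quadratic_variation
      (restricted_filtration X P (E1 Omega rho Gamma2))
      (restricted_paths X (E1 Omega rho Gamma2)) (P (Some x))
      (Mproc X Omega A rho drho Gamma2 n ell u)
      (Mbracket X Omega A u).
Proof.
move=> x Fx.
have [[V [_ G2E]] _ _ _] := hC4.
have G2cl : Gamma2 `<=` closure Omega by rewrite G2E => y [_ []].
have [cA crho _] := hC2.
have [_ cu _ _ [K [cK KF u0]]] := hu.
have uu := C2c_sqr hO G2cl crho hu.
pose q := carre_du_champ Omega A u.
have cq := carre_du_champ_continuous G2cl crho hu cA.
have q0 y : E1 Omega rho Gamma2 y -> ~ K y -> q y = 0.
  exact: (carre_du_champ_out G2cl A cK u0).
have qge0 y : E1 Omega rho Gamma2 y -> 0 <= q y by exact: (carre_du_champ_ge0 G2cl u hC1).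
have [C C0 [I [mI IC IE]]] := time_integral_version X cK KF cq q0.
have [Cq Cq0 qC] := bounded_compact_support cK KF cq q0.
have [Cu Cu0 uC] : exists2 Cu, 0 <= Cu & forall y, `|u y| <= Cu.
  have [Cu Cu0 uC] := bounded_compact_support cK KF cu (fun y _ => u0 y).
  exists Cu => // y; have [Ky|/u0->] := pselect (K y); last by rewrite normr0.
  exact/uC/KF.
have mX (s : R) (D : set (borel (one_point_compactification 'rV[R]_d))) :
    0 <= s -> measurable D -> measurable (X s @^-1` D).
  by move=> s0 mD; apply/(diff_sigma hM); apply: sub_sigma_algebra; exists s, D.
set F := E1 Omega rho Gamma2 in Fx *.
set W0 := restricted_paths X F.
have cX w := diff_cont hM w.
have subG := past_measurable mX.
have incG (s t : R) (st : s <= t) := past_le (X := X) st.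
have aeW0 := hinv x Fx.
have hm := hmart u hu x Fx; have hm2 := hmart _ uu x Fx.
have [M' [mM' M'E]] := L2_version mX Fx aeW0 hm.
have [N' [mN' N'E]] := L2_version mX Fx aeW0 hm2.
set M := Mproc X Omega A rho drho Gamma2 n ell u in hm M'E *.
set N := Mproc X Omega A rho drho Gamma2 n ell _ in hm2 N'E.
pose Q (t : R) w : R := 2 * I t w.
have QE t w : 0 <= t -> W0 w -> Mbracket X Omega A u t w = Q t w.
  by move=> t0 Ww; rewrite /Q -(IE t w t0 Ww (cX w)).
have mQ t : 0 <= t -> measurable_fun setT (Q t : g_sigma_algebraType (past X t) -> R).
  by move=> t0; apply: measurable_funM; [exact: measurable_cst|exact: mI].
have QC t w : 0 <= t -> `|Q t w| <= 2 * (C * t).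
  by move=> t0; rewrite normrM ger0_norm// ler_wpM2l// IC.
pose U t w := ext0 u (X t w).
have UC t w : `|U t w| <= Cu by rewrite /U; case: (X t w) => [y|] //=; rewrite normr0.
have mU t : 0 <= t -> measurable_fun setT (U t : g_sigma_algebraType (past X t) -> R).
  move=> t0; apply: measurable_fun_past; first by rewrite t0 lexx.
  have uE : (fun y => \1_K y * u y) = u.
    apply/funext => y; rewrite indicE; have [Ky|nK] := pselect (K y).
      by rewrite mem_set// mul1r.
    by rewrite u0// mulr0.
  by have := measurable_ext0 cK KF cu; rewrite uE.
have cq_path w : W0 w -> {within `[0, +oo[, continuous (fun s => ext0 q (X s w))}.
  by move=> Ww; exact: (path_continuous cK cq q0 Ww (cX w)).
have cu_path w : W0 w -> {within `[0, +oo[, continuous (fun s => ext0 u (X s w))}.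
  by move=> Ww; exact: (path_continuous cK cu (fun y _ => u0 y) Ww (cX w)).
(* The dyadic times are countably many, so off one null set [M'] = [M] and [N'] = [N] at all of
   them, and the estimate for the continuous path of [M] applies to the versions. *)
have rem0 s t : 0 <= s <= t -> {ae P (Some x), forall w,
    \sum_(k < 2 ^ m) `|remainder M' N' U Q s t m k w| @[m --> \oo] --> 0}.
  move=> st; have /andP[s0 s_t] := st; have t0 := le_trans s0 s_t.
  have p0 m k : 0 <= dyadic s t m k by rewrite (le_trans s0)// dyadic_ge.
  have eqM : {ae P (Some x), forall w, forall m k,
      M (dyadic s t m k) w = M' (dyadic s t m k) w}.
    apply: ae_foralln => m; apply: ae_foralln => k.
    have [Z [mZ Z0 ZE]] := M'E _ (p0 m k); exists Z; split=> // w nE.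
    by apply: contrapT => /ZE[_ e]; apply: nE.
  have eqN : {ae P (Some x), forall w, forall m k,
      N (dyadic s t m k) w = N' (dyadic s t m k) w}.
    apply: ae_foralln => m; apply: ae_foralln => k.
    have [Z [mZ Z0 ZE]] := N'E _ (p0 m k); exists Z; split=> // w nE.
    by apply: contrapT => /ZE[_ e]; apply: nE.
  have := ae_conj eqM (ae_conj eqN (ae_conj aeW0 (ae_conj (hdef u hu x Fx)
    (ae_conj (hdef _ uu x Fx) (cmart_cont hm))))).
  apply: ae_impl => w [EM [EN [Ww [/(_ Ww) D1 [/(_ Ww) D2 /(_ Ww) cM]]]]].
  have XF r : 0 <= r -> with_cemetery F (X r w) by exact: Ww.
  have sqE1 r : 0 <= r -> ext0 (Lhat Omega A rho drho (fun y => u y * u y)) (X r w) =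
      2 * (ext0 u (X r w) * ext0 (Lhat Omega A rho drho u) (X r w)) + 2 * ext0 q (X r w).
    move=> /XF; case: (X r w) => [y|] /= Fy; last by rewrite !mulr0 addr0.
    exact: (Lhat_sqr hO G2cl crho A drho hu Fy).
  have sqE2 r : 0 <= r -> ext0 (flux Omega A rho Gamma2 n (fun y => u y * u y)) (X r w) =
      2 * (ext0 u (X r w) * ext0 (flux Omega A rho Gamma2 n u) (X r w)).
    move=> /XF; case: (X r w) => [y|] /= Fy; last by rewrite !mulr0.
    exact: (flux_sqr G2cl crho A n hu Fy).
  have in0 (r b : R) : r \in `[0, b]%classic -> 0 <= r.
    by rewrite inE /= in_itv/= => /andP[].
  have [D11 D12] := D1 t t0; have [D21 D22] := D2 t t0.
  have := @sum_remainder_cvg0 R (@lebesgue_measure R) (stieltjes (ell^~ w))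
    (fun r => ext0 u (X r w)) (M^~ w) (N^~ w) (Mbracket X Omega A u ^~ w)
    (fun r => ext0 (Lhat Omega A rho drho u) (X r w))
    (fun r => ext0 (flux Omega A rho Gamma2 n u) (X r w))
    (fun r => ext0 q (X r w)) t D11 D12 (continuous_integrable t (cq_path w Ww)).
  move=> rem; have {}rem := rem _ _ _ _ _ (cu_path w Ww) cM s st.
  have e : (fun m => \sum_(k < 2 ^ m) `|remainder M' N' U Q s t m k w|) =
    (fun m => let p := dyadic s t in
      \sum_(k < 2 ^ m) `|(M (p m k.+1) w ^+ 2 - Mbracket X Omega A u (p m k.+1) w)
        - (M (p m k) w ^+ 2 - Mbracket X Omega A u (p m k) w)
        - (N (p m k.+1) w - N (p m k) w)
        - 2 * (M (p m k) w - ext0 u (X (p m k) w)) * (M (p m k.+1) w - M (p m k) w)|).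
    apply/funext => m /=; apply: eq_bigr => k _.
    by rewrite /remainder !EM !EN !QE// /U.
  rewrite e; apply: rem.
  - apply: eq_integrable D21 => // r /in0 r0; congr EFin; exact: sqE1.
  - apply: eq_integrable D22 => // r /in0 r0; congr EFin; exact: sqE2.
  - move=> r _; exact: erefl.
  - move=> r _; rewrite /N /Mproc; congr (_ - _ + _).
    + by case: (X r w) => [?|]; case: (X 0 w) => [?|] /=; rewrite ?expr2 ?mul0r ?mulr0.
    + by apply: eq_Rintegral => b /in0 /sqE1.
    + by apply: eq_Rintegral => b /in0 /sqE2.
  - move=> r _; exact: erefl.
pose Phi t w := M' t w ^+ 2 - Q t w.
have mPhi t : 0 <= t -> measurable_fun setT (Phi t : g_sigma_algebraType (past X t) -> R).
  move=> t0; apply: measurable_funB; last exact: mQ.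
  by apply: measurable_funX; exact: (L2r_adapted mM').
have mPhiT t : 0 <= t -> measurable_fun setT (Phi t).
  by move=> t0; apply: sub_sigma_measurable_fun (mPhi t t0); exact: subG.
have mQT t : 0 <= t -> measurable_fun setT (Q t).
  by move=> t0; apply: sub_sigma_measurable_fun (mQ t t0); exact: subG.
have iPhi t : 0 <= t -> (path_law P (Some x)).-integrable setT (EFin \o Phi t).
  move=> t0; apply: (@integrable_addr _ _ _ _ _ (fun w => - Q t w)).
    exact: (L2r_sq mM' t0).2.
  apply: sq_integrable_int; apply: sq_integrableN.
  by apply: (@sq_integrable_bounded _ _ _ _ (2 * (C * t))); [exact: mQT|move=> w; exact: QC].
have key s t B : 0 <= s <= t -> <<s past X s >> B ->
    \int[path_law P (Some x)]_w (\1_B w * (Phi t w - Phi s w)) = 0.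
  move=> st GB; have /andP[s0 s_t] := st.
  apply: (@compensated_increment_mean0 _ _ _ (path_law P (Some x)) (past X) subG incG
    M' N' U Q s t Cu (2 * (C * t)) st mM' mN' mU UC mQT _ (rem0 s t st) B GB).
  move=> r w /andP[r0 rt]; rewrite (le_trans (QC r w r0))// ler_wpM2l// ler_wpM2l//.
have PhiE t : 0 <= t -> exists Z, [/\ measurable Z, P (Some x) Z = 0%E &
    forall w, ~ Z w -> W0 w /\ M t w ^+ 2 - Mbracket X Omega A u t w = Phi t w].
  move=> t0; have [Z [mZ Z0 ZE]] := M'E t t0; exists Z; split=> // w /ZE[Ww e].
  by split=> //; rewrite /Phi e QE.
split.
(* [Q] agrees with the bracket on all of W0, so it serves every initial law with an empty
   exceptional set. *)
- move=> t D t0 mD; apply: version_adapted => // mu' _.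
  exists (Q t), set0; split; [exact: mQ| |by move=> w Ww _; exact: QE].
  by split=> //; rewrite (eq_integral (fun=> 0%E)) ?integral0// => y _; rewrite measure0.
- apply: ae_impl aeW0 => w _ Ww; split.
  + by rewrite /Mbracket set_itv1 Rintegral_set1 mulr0.
  + have qb r : 0 <= r -> `|ext0 q (X r w)| <= Cq.
      move=> r0; have := Ww r r0; case: (X r w) => [y|] /= Fy; first exact: qC.
      by rewrite normr0.
    have := time_integral_continuous (cq_path w Ww) qb => ci y.
    by apply: cvgM; [exact: cvg_cst|exact: ci].
  + move=> s t st; have /andP[s0 s_t] := st.
    rewrite /Mbracket ler_pM2l// -subr_ge0.
    rewrite (Rintegral_increment st (continuous_integrable t (cq_path w Ww))).
    apply: Rintegral_ge0 => r; rewrite /= in_itv/= => /andP[sr _].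
    have := Ww r (le_trans s0 (ltW sr)); case: (X r w) => [y|] //= Fy.
    exact: qge0.
split.
- move=> t D t0 mD; apply: (@version_adapted _ _ _ _ X P F
    (fun r w => M r w ^+ 2 - Mbracket X Omega A u r w)) => // mu' mu1.
  (* [M'] is a version for P_x only, while adaptedness requires one for each initial law; a fresh
     version is taken for [mu']. *)
  have [g [Z [mg nZ gE]]] := adapted_version mu1 (mart_adapted (cmart_mart hm)) t0.
  exists (fun w => g w ^+ 2 - Q t w), Z; split=> //.
    by apply: measurable_funB; [exact: measurable_funX|exact: mQ].
  by move=> w Ww nw; rewrite (gE w Ww nw) QE.
- move=> t t0; have [Z [mZ Z0 ZE]] := PhiE t t0.
  rewrite (@integral_version _ _ _ _ _ (fun w => `|Phi t w|%:E) _ setT Z)//.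
  + by have /integrableP[] := iPhi t t0.
  + by apply/measurable_EFinP; apply: measurableT_comp => //; exact: mPhiT.
  + by move=> w /ZE[].
  + by move=> w /ZE[_ ->].
- move=> s t B st FB; have /andP[s0 s_t] := st; have t0 := le_trans s0 s_t.
  (* The event [B] of the completed filtration is exchanged, under the Dirac law at x, for an event
     [D] of the raw past, to which [key] applies. *)
  have [BW [D [Z [GD nZ DE]]]] := filtration_past (dirac_state Fx) FB.
  have mD := subG _ _ GD.
  have [mZ Z0] := (null_from_dirac P x Z).1 nZ.
  have toD r : 0 <= r ->
      (\int[P (Some x)]_(w in B) (M r w ^+ 2 - Mbracket X Omega A u r w)%:E =
       \int[P (Some x)]_(w in D) (Phi r w)%:E)%E.
    move=> r0; have [Y [mY Y0 YE]] := PhiE r r0.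
    have [mU' U0] : measurable (Z `|` Y) /\ P (Some x) (Z `|` Y) = 0%E.
      by apply/null_from_dirac/null_fromU => //; exact/null_from_dirac.
    apply: (@integral_version _ _ _ _ _ _ _ _ (Z `|` Y)) => //.
    + by apply/measurable_EFinP; exact: mPhiT.
    + by move=> w /not_orP[Zw /YE[Ww _]]; exact: DE.
    + by move=> w /not_orP[_ /YE[_ ->]].
  rewrite !toD//.
  have iD r : 0 <= r -> (path_law P (Some x)).-integrable D (EFin \o Phi r).
    by move=> r0; apply: integrableS (iPhi r r0).
  have h := key s t D st GD.
  have fin r : 0 <= r -> (\int[P (Some x)]_(w in D) (Phi r w)%:E)%E \is a fin_num.
    by move=> r0; have := integrable_fin_num mD (iD r r0).
  rewrite -[LHS]fineK ?fin// -[RHS]fineK ?fin//; congr EFin.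
  apply/eqP; rewrite -subr_eq0; apply/eqP; rewrite -[RHS]h.
  have -> : \int[path_law P (Some x)]_w (\1_D w * (Phi t w - Phi s w)) =
      \int[path_law P (Some x)]_(w in D) (Phi t w - Phi s w).
    rewrite [RHS]Rintegral_mkcond; apply: eq_Rintegral => w _.
    by rewrite patchE indicE; case: ifP => _; rewrite ?mul1r ?mul0r.
  by rewrite RintegralB//; exact: iD.
Qed.
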